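(* Let $\mathcal{B}_{\mathrm{pt}}$ be the set of bounded operators $S$ on $L^2(\mathbb{R}^d)$ such that, whenever $f_n\rightharpoonup f$ weakly in $L^2(\mathbb{R}^d)$, one has $Q_Sf_n(z)\to Q_Sf(z)$ for every $z\in\mathbb{R}^{2d}$. Then $\mathcal{B}_{\mathrm{pt}}=\mathcal{K}$, where $\mathcal{K}$ is the set of compact operators on $L^2(\mathbb{R}^d)$.
   Context: $L^2(\mathbb{R}^d)$ is a complex Hilbert space with inner product linear in the first entry. For $z=(x,\xi)\in\mathbb{R}^{2d}$, $\pi(z)f(y)=e^{2\pi i\xi\cdot y}f(y-x)$; for a bounded operator $S$ on $L^2(\mathbb{R}^d)$, $\alpha_z(S)=\pi(z)S\pi(z)^*$ and $Q_Sf(z)=\langle\alpha_z(S)f,f\rangle$. *)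

(* Defs.v *)
(* Conventions.  L^2(mu) is the complex Hilbert space of classes, modulo equality
   almost everywhere, of measurable square-integrable functions with values in
   R[i]; the inner product [L2dot] is linear in its first argument.  R^d is
   'rV[R]_d, and a point z = (x, xi) of R^{2d} is a pair of elements of R^d. *)
From HB Require Import structures.
From mathcomp Require Import all_boot all_order all_algebra.
From mathcomp Require Import sesquilinear ring_quotient.
From mathcomp Require Import all_classical all_reals all_analysis measurable_realfun.
From mathcomp Require Import complex.
From mathcomp Require Import ring.
Set Implicit Arguments.
Unset Strict Implicit.
Unset Printing Implicit Defensive.
Import Order.TTheory GRing.Theory Num.Def Num.Theory.
Import numFieldNormedType.Exports.

Local Open Scope classical_set_scope.
Local Open Scope ring_scope.
Local Open Scope quotient_scope.
Local Open Scope complex_scope.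

Definition rV_display : measure_display. Proof. exact. Qed.

(* 'rV[R]_n carries the sigma-algebra generated by the coordinates, i.e. the
   product of n copies of the Borel sigma-algebra of R. *)
Section rV_measurable.
Variables (R : realType) (n : nat).

Let coors : 'I_n -> 'rV[R]_n -> measurableTypeR R := fun i x => x ord0 i.

Let rV_set0 : g_sigma_preimage coors set0.
Proof. exact: sigma_algebra0. Qed.

Let rV_setC A : g_sigma_preimage coors A -> g_sigma_preimage coors (~` A).
Proof. exact: sigma_algebraC. Qed.

Let rV_bigcup (F : _^nat) : (forall i, g_sigma_preimage coors (F i)) ->
  g_sigma_preimage coors (\bigcup_i (F i)).
Proof. exact: sigma_algebra_bigcup. Qed.

HB.instance Definition _ := @isMeasurable.Build rV_display
  'rV[R]_n (g_sigma_preimage coors) rV_set0 rV_setC rV_bigcup.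

Lemma measurable_coord (i : 'I_n) :
  measurable_fun [set: 'rV[R]_n] (fun x => x ord0 i : measurableTypeR R).
Proof.
move=> _ Y mY; rewrite setTI; apply: sub_sigma_algebra => /=.
rewrite -bigcup_seq/=; exists i => /=; first by rewrite mem_index_enum.
by exists Y => //; rewrite setTI.
Qed.

Lemma measurable_fun_rVP d (T : measurableType d) (f : T -> 'rV[R]_n) :
  (forall i, measurable_fun [set: T] (fun x => f x ord0 i : measurableTypeR R)) ->
  measurable_fun [set: T] f.
Proof.
move=> mf.
have H : g_sigma_preimage (fun i x => f x ord0 i : measurableTypeR R)
    `<=` @measurable _ T.
  apply: smallest_sub; first exact: sigma_algebra_measurable.
  apply: (big_ind (fun X : set (set T) => X `<=` measurable)).
  - by [].
  - by move=> X Y hX hY; rewrite subUset.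
  - by move=> i _ A [B mB <-]; exact: mf.
move=> _ A mA; rewrite setTI; apply: H.
rewrite (_ : (fun i x => _) = (fun i => coors i \o f))// g_sigma_preimage_comp.
by exists A => //; rewrite setTI.
Qed.

End rV_measurable.

Definition measurable_pushforward d d' (T1 : measurableType d)
    (T2 : measurableType d') (R : realType) (m : {measure set T1 -> \bar R})
    (f : T1 -> T2) (mf : measurable_fun setT f) : {measure set T2 -> \bar R}.
Proof. by refine (pushforward m f : {measure set T2 -> \bar R}). Defined.

Section rV_cons.
Variables (R : realType) (n : nat).
Local Notation MR := (measurableTypeR R).

Definition rV_cons (p : MR * 'rV[R]_n) : 'rV[R]_n.+1 := row_mx (p.1)%:M p.2.
Lemma rV_cons0 p : rV_cons p ord0 ord0 = p.1.
Proof.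
transitivity ((row_mx (p.1)%:M p.2 : 'rV[R]_(1 + n)) ord0 (lshift n (ord0 : 'I_1))).
  by congr (row_mx _ _ _ _); exact: val_inj.
by rewrite row_mxEl mxE eqxx mulr1n.
Qed.

Lemma rV_consS p i : rV_cons p ord0 (lift ord0 i) = p.2 ord0 i.
Proof.
transitivity ((row_mx (p.1)%:M p.2 : 'rV[R]_(1 + n)) ord0 (rshift 1 i)).
  by congr (row_mx _ _ _ _); exact: val_inj.
by rewrite row_mxEr.
Qed.

Definition rV_uncons (v : 'rV[R]_n.+1) : MR * 'rV[R]_n :=
  (v ord0 ord0, \row_i v ord0 (lift ord0 i)).

Lemma rV_consK : cancel rV_cons rV_uncons.
Proof.
move=> [a v]; rewrite /rV_uncons rV_cons0; congr pair.
by apply/rowP => i; rewrite mxE rV_consS.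
Qed.

Lemma rV_unconsK : cancel rV_uncons rV_cons.
Proof.
move=> v; apply/rowP => i; have [j ->|->] := unliftP ord0 i.
  by rewrite rV_consS mxE.
by rewrite rV_cons0.
Qed.

Lemma measurable_rV_cons : measurable_fun setT rV_cons.
Proof.
apply: measurable_fun_rVP => i; have [j ->|->] := unliftP ord0 i.
  under eq_fun do rewrite rV_consS.
  apply: (measurableT_comp (f := fun v : 'rV[R]_n => v ord0 j : MR)) => //.
  exact: measurable_coord.
under eq_fun do rewrite rV_cons0.
exact: measurable_fst.
Qed.

Lemma measurable_rV_uncons : measurable_fun setT rV_uncons.
Proof.
apply/measurable_fun_pair => /=; first exact: measurable_coord.
apply: measurable_fun_rVP => i.
under eq_fun do rewrite mxE.
exact: measurable_coord.
Qed.

Variable mu : {sigma_finite_measure set 'rV[R]_n -> \bar R}.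

Definition lebesgue_rV_step : set 'rV[R]_n.+1 -> \bar R :=
  measurable_pushforward (lebesgue_measure \x mu)%E measurable_rV_cons.

HB.instance Definition _ := Measure.on lebesgue_rV_step.

Let sigma_finite_step : sigma_finite setT lebesgue_rV_step.
Proof.
have /sigma_finiteP[F [TF ndF Foo]] := sigma_finiteT (@lebesgue_measure R).
have /sigma_finiteP[G [TG ndG Goo]] := sigma_finiteT mu.
exists (fun k => rV_uncons @^-1` (F k `*` G k)).
  rewrite -preimage_bigcup (_ : \bigcup_k _ = setT) ?preimage_setT//.
  rewrite -setXTT TF TG predeqE => -[x y]; split.
    by move=> [n0 _ []/= ? ?]; split; exists n0.
  move=> [/= [j _ Fjx] [k _ Gky]]; exists (maxn j k) => //; split.
  - by move: x Fjx; exact/subsetPset/ndF/leq_maxl.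
  - by move: y Gky; exact/subsetPset/ndG/leq_maxr.
move=> k; have [mFk Fk] := Foo k; have [mGk Gk] := Goo k; split.
  rewrite -[X in measurable X]setTI; apply: measurable_rV_uncons => //.
  exact: measurableX.
rewrite /lebesgue_rV_step /= /pushforward -comp_preimage.
rewrite (_ : _ \o _ = id); last by apply/funext => x /=; rewrite rV_consK.
by rewrite preimage_id product_measure1E// lte_mul_pinfty// ge0_fin_numE.
Qed.

HB.instance Definition _ := Measure_isSigmaFinite.Build _ _ _
  lebesgue_rV_step sigma_finite_step.

End rV_cons.

(* Lebesgue measure on R^n, as an iterated product; it is the product measure on
   boxes by [lebesgue_rV_box] below. *)
Fixpoint lebesgue_rV (R : realType) (n : nat) :
    {sigma_finite_measure set 'rV[R]_n -> \bar R} :=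
  match n with
  | 0 => \d_(0 : 'rV[R]_0)
  | m.+1 => lebesgue_rV_step (lebesgue_rV R m)
  end.

Lemma lebesgue_rVS (R : realType) n (A : set 'rV[R]_n.+1) :
  lebesgue_rV R n.+1 A = ((lebesgue_measure \x lebesgue_rV R n) (@rV_cons R n @^-1` A))%E.
Proof. by []. Qed.

Lemma lebesgue_rV_box (R : realType) n (A : 'I_n -> set (measurableTypeR R)) :
  (forall i, measurable (A i)) ->
  lebesgue_rV R n [set x | forall i, A i (x ord0 i)] =
  (\prod_(i < n) lebesgue_measure (A i))%E.
Proof.
elim: n A => [|n IH] A mA.
  rewrite big_ord0 /= diracE.
  by rewrite mem_set//= => -[].
have mbox : measurable [set x : 'rV[R]_n | forall i, A (lift ord0 i) (x ord0 i)].
  rewrite (_ : mkset _ = \big[setI/setT]_(i < n)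
     ((fun x : 'rV[R]_n => x ord0 i : measurableTypeR R) @^-1` A (lift ord0 i))).
    apply: bigsetI_measurable => i _; rewrite -[X in measurable X]setTI.
    exact: measurable_coord.
  rewrite -bigcap_seq; apply/seteqP; split => x /= h i; first by move=> _; exact: h.
  by apply: (h i); rewrite /= mem_index_enum.
rewrite lebesgue_rVS big_ord_recl -IH// -product_measure1E//.
congr ((_ \x _) _)%E; apply/seteqP; split => -[a v] /=.
- move=> h; split => [|i]; first by have := h ord0; rewrite rV_cons0.
  by have := h (lift ord0 i); rewrite rV_consS.
- move=> [h0 h] i; have [j ->|->] := unliftP ord0 i; last by rewrite rV_cons0.
  by rewrite rV_consS.
Qed.

Lemma lebesgue_measure_shift (R : realType) (a : R) (A : set (measurableTypeR R)) :
  measurable A ->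
  lebesgue_measure ((fun x => x - a : measurableTypeR R) @^-1` A) = lebesgue_measure A.
Proof.
move=> mA.
pose f := fun x : measurableTypeR R => x - a : measurableTypeR R.
have mf : measurable_fun setT f by exact: measurable_funB.
apply/esym.
apply: (@lebesgue_measure_unique R (measurable_pushforward lebesgue_measure mf)) => // X [[x y] _ <-].
rewrite /= /pushforward (_ : f @^-1` _ = `](x + a), (y + a)]%classic).
  rewrite !lebesgue_measure_itv/= !lte_fin ltrD2r; case: ifP => // _.
  by rewrite -!EFinB; congr EFin; rewrite opprD addrACA subrr addr0.
by apply/seteqP; split => z /=; rewrite !in_itv/= ltrBrDr lerBlDr.
Qed.

Lemma measurable_shift (R : realType) n (x : 'rV[R]_n) :
  measurable_fun setT (fun y : 'rV[R]_n => y - x).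
Proof.
apply: measurable_fun_rVP => i.
rewrite (_ : (fun y => _) = (fun y : 'rV[R]_n => y ord0 i - x ord0 i : measurableTypeR R)).
  by apply: measurable_funB => //; exact: measurable_coord.
by apply/funext => y; rewrite !mxE.
Qed.

Lemma lebesgue_rV_shift (R : realType) n (x : 'rV[R]_n) (A : set 'rV[R]_n) :
  measurable A ->
  lebesgue_rV R n ((fun y => y - x) @^-1` A) = lebesgue_rV R n A.
Proof.
elim: n x A => [|n IH] x A mA.
  by congr (lebesgue_rV R 0 _); apply/seteqP; split => y /=; rewrite [y - x]thinmx0 [y]thinmx0.
rewrite !lebesgue_rVS -comp_preimage.
pose T := fun p : measurableTypeR R * 'rV[R]_n =>
  (p.1 - (rV_uncons x).1 : measurableTypeR R, p.2 - (rV_uncons x).2).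
have -> : (fun y => y - x) \o @rV_cons R n = @rV_cons R n \o T.
  apply/funext => -[a v] /=; apply: (can_inj (@rV_unconsK R n)); rewrite rV_consK.
  rewrite /rV_uncons /T /=; congr pair.
    by rewrite mxE rV_cons0 mxE.
  by apply/rowP => i; rewrite mxE [LHS]mxE rV_consS !mxE.
have mT : measurable_fun setT T.
  apply/measurable_fun_pair => /=; first exact: measurable_funB.
  exact: (measurableT_comp (measurable_shift (rV_uncons x).2) measurable_snd).
have mA' : measurable (@rV_cons R n @^-1` A).
  by rewrite -[X in measurable X]setTI; exact: measurable_rV_cons.
rewrite comp_preimage.
rewrite [RHS](@product_measure_unique _ _ _ _ _ _ _
  (measurable_pushforward (lebesgue_measure \x lebesgue_rV R n)%E mT))// => B C mB mC.
rewrite /= /pushforward.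
rewrite (_ : T @^-1` _ = ((fun x0 => x0 - (rV_uncons x).1 : measurableTypeR R) @^-1` B)
   `*` ((fun y => y - (rV_uncons x).2) @^-1` C))//.
rewrite product_measure1E.
- by congr (_ * _)%E; [exact: lebesgue_measure_shift|exact: IH].
- by rewrite -[X in measurable X]setTI; exact: measurable_funB.
- by rewrite -[X in measurable X]setTI; exact: measurable_shift.
Qed.

(* The topology of R[i] is that of the modulus. Only the metric structure is
   copied from R[i]^o: R[i] itself already is an lmodType over R. *)
HB.instance Definition _ (R : realType) := PseudoMetricNormedZmod.copy R[i] R[i]^o.

Section L2_functions.
Context {d : measure_display} {T : measurableType d} {R : realType}.
Variable mu : {measure set T -> \bar R}.

Definition cintegral (f : T -> R[i]) : R[i] :=
  (\int[mu]_x complex.Re (f x)) +i* (\int[mu]_x complex.Im (f x)).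

Definition L2_pred : {pred T -> R[i]^o} := mem [set f : T -> R[i]^o |
  [/\ measurable_fun [set: T] (fun x => complex.Re (f x) : R),
      measurable_fun [set: T] (fun x => complex.Im (f x) : R) &
      (\int[mu]_x ((Normc.normc (f x)) ^+ 2)%:E < +oo)%E]].

Lemma Lfun2P (g : T -> R) : g \in Lfun mu 2%:E <->
  measurable_fun setT g /\ (\int[mu]_x ((g x) ^+ 2)%:E < +oo)%E.
Proof.
split=> [L2g|[mg g2]].
  have /integrableP[_] := Lfun2_integrable_sqr L2g.
  under eq_integral do rewrite /= ger0_norm ?sqr_ge0//.
  split => //; by move: L2g; rewrite inE => /andP[]; rewrite inE.
rewrite inE; apply/andP; split; rewrite inE//= /finite_norm unlock poweR_lty//.
under eq_integral do rewrite /= powR_mulrn// real_normK ?num_real//.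
by [].
Qed.

Lemma sqr_Re_normc (z : R[i]) : Normc.normc z ^+ 2 = complex.Re z ^+ 2 + complex.Im z ^+ 2.
Proof. by case: z => a b /=; rewrite sqr_sqrtr// addr_ge0 ?sqr_ge0. Qed.

Lemma L2_predP (f : T -> R[i]^o) : f \in L2_pred <->
  (fun x => complex.Re (f x)) \in Lfun mu 2%:E /\
  (fun x => complex.Im (f x)) \in Lfun mu 2%:E.
Proof.
have Efun : (\int[mu]_x ((Normc.normc (f x)) ^+ 2)%:E =
    \int[mu]_x ((complex.Re (f x)) ^+ 2 + (complex.Im (f x)) ^+ 2)%:E)%E.
  by apply: eq_integral => x _; rewrite sqr_Re_normc.
rewrite !Lfun2P inE /=; rewrite Efun; split.
  move=> [mR mI fin]; split; split => //; apply: le_lt_trans fin.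
    apply: ge0_le_integral => //.
    - by move=> x _; rewrite lee_fin sqr_ge0.
    - by apply/measurable_EFinP; exact: measurable_funX.
    - by apply/measurable_EFinP; apply: measurable_funD; exact: measurable_funX.
    - by move=> x _; rewrite lee_fin lerDl sqr_ge0.
  apply: ge0_le_integral => //.
  - by move=> x _; rewrite lee_fin sqr_ge0.
  - by apply/measurable_EFinP; exact: measurable_funX.
  - by apply/measurable_EFinP; apply: measurable_funD; exact: measurable_funX.
  - by move=> x _; rewrite lee_fin lerDr sqr_ge0.
move=> [[mR fR] [mI fI]]; split => //.
under eq_integral do rewrite EFinD.
rewrite ge0_integralD//.
- by rewrite lte_add_pinfty.
- by move=> x _; rewrite lee_fin sqr_ge0.
- by apply/measurable_EFinP; exact: measurable_funX.
- by move=> x _; rewrite lee_fin sqr_ge0.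
- by apply/measurable_EFinP; exact: measurable_funX.
Qed.

Let p12 : (1 <= 2%:E :> \bar R)%E. Proof. by rewrite lee_fin ler1n. Qed.

Lemma Lfun2_lin (a b : R) (u v : T -> R) : u \in Lfun mu 2%:E -> v \in Lfun mu 2%:E ->
  (fun x => a * u x + b * v x) \in Lfun mu 2%:E.
Proof.
move=> hu hv.
have [c0 cl] := Lfun_submod_closed mu p12.
have h1 := cl a u 0 hu c0.
have h2 := cl b v _ hv h1.
rewrite (_ : (fun x => _) = b *: v + (a *: u + 0))//.
by apply/funext => x; rewrite !fctE addr0 addrC.
Qed.

Lemma L2_submod_closed : submod_closed L2_pred.
Proof.
split.
  have [c0 _] := Lfun_submod_closed mu p12.
  by apply/L2_predP; split; exact: c0.
move=> a f g /L2_predP[fR fI] /L2_predP[gR gI]; apply/L2_predP; split.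
- rewrite (_ : (fun x => _) = fun x =>
      1 * (complex.Re a * complex.Re (f x) + (- complex.Im a) * complex.Im (f x))
      + 1 * complex.Re (g x)); first by do 2?apply: Lfun2_lin.
  apply/funext => x; rewrite !fctE /= !mul1r mulNr.
  by case: a (f x) (g x) => ? ? [? ?] [? ?].
- rewrite (_ : (fun x => _) = fun x =>
      1 * (complex.Re a * complex.Im (f x) + complex.Im a * complex.Re (f x))
      + 1 * complex.Im (g x)); first by do 2?apply: Lfun2_lin.
  apply/funext => x; rewrite !fctE /= !mul1r.
  by case: a (f x) (g x) => ? ? [? ?] [? ?].
Qed.

HB.instance Definition _ := GRing.isSubmodClosed.Build _ _ L2_pred L2_submod_closed.

Record L2fun := MkL2fun { L2val :> T -> R[i]^o ; L2valP : L2val \in L2_pred }.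

HB.instance Definition _ := [isSub of L2fun for L2val].
HB.instance Definition _ := gen_eqMixin L2fun.
HB.instance Definition _ := [Choice of L2fun by <:].
HB.instance Definition _ := [SubChoice_isSubLmodule of L2fun by <:].

Definition ae0_pred : {pred L2fun} := mem [set f : L2fun | {ae mu, forall x, f x = 0}].

Lemma ae0_zmod_closed : zmod_closed ae0_pred.
Proof.
split; first by rewrite inE /=; apply: aeW.
move=> f g; rewrite !inE /= => hf hg.
by apply: filterS2 hf hg => x; rewrite !fctE => -> ->; rewrite subr0.
Qed.

HB.instance Definition _ := GRing.isZmodClosed.Build _ ae0_pred ae0_zmod_closed.

Definition L2 : Type := {ideal_quot ae0_pred}.
HB.instance Definition _ := Choice.on L2.
HB.instance Definition _ := GRing.Zmodule.on L2.
HB.instance Definition _ := EqQuotient.on L2.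
HB.instance Definition _ := ZmodQuotient.on L2.

Lemma eq_L2P (f g : L2fun) :
  \pi_L2 f = \pi_L2 g <-> {ae mu, forall x, f x = g x}.
Proof.
split.
  move=> /eqP; rewrite -[_ == _]Quotient.idealrBE inE /= => h.
  by apply: filterS h => x; rewrite !fctE => /eqP; rewrite subr_eq0 => /eqP.
move=> h; apply/eqP; rewrite -[_ == _]Quotient.idealrBE inE /=.
by apply: filterS h => x; rewrite !fctE => ->; rewrite subrr.
Qed.

Lemma L2_scale_subproof (a : R[i]) (f : L2fun) :
  \pi_L2 (a *: f) = \pi_L2 (a *: repr (\pi_L2 f)).
Proof.
apply/eq_L2P; have /eq_L2P := reprK (\pi_L2 f).
by apply: filterS => x e; rewrite /= !fctE e.
Qed.

Definition L2_scale (a : R[i]) (u : L2) : L2 := \pi_L2 (a *: repr u).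

Let L2_scaleE a (f : L2fun) : L2_scale a (\pi_L2 f) = \pi_L2 (a *: f).
Proof. by rewrite /L2_scale -L2_scale_subproof. Qed.

Let L2_scaleA a b u : L2_scale a (L2_scale b u) = L2_scale (a * b) u.
Proof. by rewrite -[u]reprK (L2_scaleE b) (L2_scaleE a) (L2_scaleE (a * b)) scalerA. Qed.

Let L2_scale1 : left_id 1 L2_scale.
Proof. by move=> u; rewrite -[u]reprK L2_scaleE scale1r. Qed.

Let L2_scaleDr : right_distributive L2_scale +%R.
Proof.
move=> a u v; rewrite -[u]reprK -[v]reprK -(raddfD \pi_L2) !L2_scaleE.
by rewrite scalerDr (raddfD \pi_L2).
Qed.

Let L2_scaleDl u : {morph L2_scale^~ u : a b / a + b}.
Proof.
move=> a b; rewrite -[u]reprK !L2_scaleE scalerDl.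
by rewrite (raddfD \pi_L2).
Qed.

HB.instance Definition _ := GRing.Zmodule_isLmodule.Build R[i] L2
  L2_scaleA L2_scale1 L2_scaleDr L2_scaleDl.

Lemma pi_L2Z a (f : L2fun) : \pi_L2 (a *: f) = a *: \pi_L2 f.
Proof. by rewrite -L2_scaleE. Qed.

Lemma pi_L2D (f g : L2fun) : \pi_L2 (f + g) = \pi_L2 f + \pi_L2 g.
Proof. exact: raddfD. Qed.

Lemma pi_L20 : \pi_L2 0 = 0.
Proof. exact: raddf0. Qed.

Definition L2dot (u v : L2) : R[i] :=
  cintegral (fun x => repr u x * conjC (repr v x)).

Lemma measurable_L2fun (f : L2fun) :
  measurable_fun [set: T] (fun x => complex.Re (f x) : R) /\
  measurable_fun [set: T] (fun x => complex.Im (f x) : R).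
Proof. by have := L2valP f; rewrite inE => -[]. Qed.

Lemma integrable_L2mul (f g : L2fun) :
  mu.-integrable setT (EFin \o (fun x => complex.Re (f x * conjC (g x)))) /\
  mu.-integrable setT (EFin \o (fun x => complex.Im (f x * conjC (g x)))).
Proof.
have /L2_predP[fR fI] := L2valP f; have /L2_predP[gR gI] := L2valP g.
have H u v : u \in Lfun mu 2%:E -> v \in Lfun mu 2%:E ->
    mu.-integrable setT (EFin \o (u \* v)).
  by move=> hu hv; apply/Lfun1_integrable; exact: Lfun2_mul_Lfun1.
split.
- apply: (eq_integrable _ (fun x =>
     (complex.Re (f x) * complex.Re (g x))%:E + (complex.Im (f x) * complex.Im (g x))%:E)%E) => //.
    move=> x _ /=; rewrite -EFinD; congr EFin.
    by case: (f x) (g x) => ? ? [? ?] /=; rewrite mulrN opprK.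
  by apply: integrableD => //; exact: H.
- apply: (eq_integrable _ (fun x =>
     (complex.Im (f x) * complex.Re (g x))%:E - (complex.Re (f x) * complex.Im (g x))%:E)%E) => //.
    move=> x _ /=; rewrite -EFinB; congr EFin.
    by case: (f x) (g x) => ? ? [? ?] /=; rewrite mulrN addrC.
  by apply: integrableB => //; exact: H.
Qed.

Lemma L2dotE (f g : L2fun) :
  L2dot (\pi_L2 f) (\pi_L2 g) = cintegral (fun x => f x * conjC (g x)).
Proof.
have /eq_L2P ef := reprK (\pi_L2 f); have /eq_L2P eg := reprK (\pi_L2 g).
have [m1 m2] := integrable_L2mul f g.
have [n1 n2] := integrable_L2mul (repr (\pi_L2 f)) (repr (\pi_L2 g)).
congr (_ +i* _); congr fine; apply: ae_eq_integral => //.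
- exact: (measurable_int mu).
- exact: (measurable_int mu).
- by apply: filterS2 ef eg => x /= -> -> _.
- exact: (measurable_int mu).
- exact: (measurable_int mu).
- by apply: filterS2 ef eg => x /= -> -> _.
Qed.

Let L2dot_linearl v : scalar (L2dot^~ v).
Proof.
move=> a u w; rewrite -[u]reprK -[w]reprK -[v]reprK -pi_L2Z -pi_L2D !L2dotE.
set f := repr u; set h := repr w; set g := repr v.
have [r1 i1] := integrable_L2mul f g; have [r2 i2] := integrable_L2mul h g.
have Z (c : R) (k : T -> R) : mu.-integrable setT (EFin \o k) ->
    mu.-integrable setT (EFin \o (fun x => c * k x)).
  move=> ik; apply: (eq_integrable _ (fun x => c%:E * (k x)%:E)%E) => //.
  exact: integrableZl.
have D (k l : T -> R) : mu.-integrable setT (EFin \o k) ->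
    mu.-integrable setT (EFin \o l) ->
    mu.-integrable setT (EFin \o (fun x => k x + l x)).
  by move=> ik il; apply: (integrableD _ ik il).
rewrite /cintegral; case: a => p q; rewrite /= !fctE; congr (_ +i* _).
- rewrite -mulNr -!RintegralZl//.
  rewrite -RintegralD//; [|exact: Z|exact: Z].
  rewrite -RintegralD//; [|by apply: D; exact: Z].
  apply: eq_Rintegral => x _; 
  by case: (f x) (g x) (h x) => ? ? [? ?] [? ?] /=; ring.
- rewrite -!RintegralZl//.
  rewrite -RintegralD//; [|exact: Z|exact: Z].
  rewrite -RintegralD//; [|by apply: D; exact: Z].
  apply: eq_Rintegral => x _; 
  by case: (f x) (g x) (h x) => ? ? [? ?] [? ?] /=; ring.
Qed.

Let L2dot_conj u v : L2dot u v = conjC (L2dot v u).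
Proof.
rewrite -[u]reprK -[v]reprK !L2dotE.
set f := repr u; set g := repr v.
have [r1 i1] := integrable_L2mul g f.
rewrite /cintegral -[RHS]/(_ +i* - _); congr (_ +i* _).
  by apply: eq_Rintegral => x _; case: (f x) (g x) => ? ? [? ?] /=; ring.
rewrite -mulN1r -RintegralZl//.
by apply: eq_Rintegral => x _; case: (f x) (g x) => ? ? [? ?] /=; ring.
Qed.

Let L2dot_linearr u : linear_for (conjC \; *%R) (L2dot u).
Proof.
move=> a v w /=; rewrite L2dot_conj L2dot_linearl rmorphD rmorphM.
by rewrite (L2dot_conj u v) (L2dot_conj u w).
Qed.

HB.instance Definition _ := bilinear_isBilinear.Build R[i] L2 L2 R[i]
  *%R (conjC \; *%R) L2dot (L2dot_linearl, L2dot_linearr).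

Let L2dot_herm u v : L2dot u v = (-1) ^+ false * conjC (L2dot v u).
Proof. by rewrite expr0 mul1r -L2dot_conj. Qed.

HB.instance Definition _ := isHermitianSesquilinear.Build R[i] L2 false conjC
  L2dot L2dot_herm.

Lemma L2dot_normc (f : L2fun) :
  L2dot (\pi_L2 f) (\pi_L2 f) = (\int[mu]_x (Normc.normc (f x) ^+ 2))%:C.
Proof.
rewrite L2dotE; congr (_ +i* _).
  apply: eq_Rintegral => x _; rewrite sqr_Re_normc.
  by case: (f x) => a b /=; rewrite mulrN opprK !expr2.
rewrite [RHS](_ : _ = \int[mu]_(x in setT) 0).
  by apply: eq_Rintegral => x _; case: (f x) => a b /=; ring.
by rewrite Rintegral_cst// mul0r.
Qed.

Let L2dot_gt0 u : u != 0 -> 0 < L2dot u u.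
Proof.
rewrite -[u]reprK; set f := repr u => u0.
have [r1 i1] := integrable_L2mul f f.
rewrite L2dot_normc ltcR lt_neqAle Rintegral_ge0 ?andbT//; last first.
  by move=> x _; exact: sqr_ge0.
apply: contra_neq u0 => int0; rewrite -pi_L20; apply/eq_L2P.
have E : EFin \o (fun x => complex.Re (f x * conjC (f x))) =
    (fun x => (Normc.normc (f x) ^+ 2)%:E).
  apply/funext => x /=; rewrite sqr_Re_normc.
  by case: (f x) => a b /=; rewrite mulrN opprK !expr2.
have mf := measurable_int mu r1.
rewrite E in r1 mf.
have /ae_eq_integral_abs : (\int[mu]_x `|(Normc.normc (f x) ^+ 2)%:E| = 0)%E.
  under eq_integral do rewrite gee0_abs ?lee_fin ?sqr_ge0//.
  rewrite -[LHS]fineK; last exact: integrable_fin_num.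
  by congr EFin; rewrite [RHS]int0.
move=> /(_ measurableT mf); apply: filterS => x /= /(_ I)[] /eqP.
by rewrite sqrf_eq0 => /eqP/Normc.eq0_normc.
Qed.

HB.instance Definition _ := isDotProduct.Build R[i] L2 L2dot L2dot_gt0.

End L2_functions.


Section dot_norm.
Variables (C : numClosedFieldType) (U : lmodType C) (form : {dot U for conjC}).
Local Notation "''[' u , v ]" := (form u%R v%R) : ring_scope.

Lemma dot_CauchySchwarz (u v : U) : `|'[u, v]| ^+ 2 <= '[u, u] * '[v, v].
Proof.
have [->|v0] := eqVneq v 0; first by rewrite linear0r normr0 expr0n mulr_ge0.
have vv : 0 < '[v, v] by rewrite dnorm_gt0.
pose w := u - ('[u, v] / '[v, v]) *: v.
have wv : '[w, v] = 0.
  by rewrite linearBl/= linearZl_LR divfK ?gt_eqF// subrr.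
have -> : '[u, u] = '[w, w] + `|'[u, v] / '[v, v]| ^+ 2 * '[v, v].
  rewrite -dnormZ -hnormDd ?subrK//.
  by rewrite linearZr_LR/= wv mulr0.
rewrite mulrDl normf_div (ger0_norm (ltW vv)) -mulrA -expr2 expr_div_n.
by rewrite divfK ?lerDr ?mulr_ge0// ?expf_neq0// gt_eqF.
Qed.

Lemma dot_triangle (u v : U) :
  sqrtC '[u + v, u + v] <= sqrtC '[u, u] + sqrtC '[v, v].
Proof.
rewrite -ler_sqr ?nnegrE ?addr_ge0 ?sqrtC_ge0//.
rewrite sqrrD !sqrtCK addrAC dnormD lerD2l -mulr_natr.
rewrite -[_ + _](divfK (negbT (pnatr_eq0 C 2))) -ReE ler_pM2r ?ltr0n//.
apply: (le_trans (leif_Re_Creal _)).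
by rewrite -(sqrCK (normr_ge0 _)) -sqrtCM ?nnegrE// ler_sqrtC ?nnegrE ?mulr_ge0 ?exprn_ge0// dot_CauchySchwarz.
Qed.

End dot_norm.

Section L2_norm.
Context {d : measure_display} {T : measurableType d} {R : realType}.
Variable mu : {measure set T -> \bar R}.

Definition L2norm (u : L2 mu) : R[i] := sqrtC (L2dot u u).

Let L2normD (u v : L2 mu) : L2norm (u + v) <= L2norm u + L2norm v.
Proof. exact: dot_triangle. Qed.

Let L2normZ (a : R[i]) (u : L2 mu) : L2norm (a *: u) = `|a| * L2norm u.
Proof.
rewrite /L2norm dnormZ sqrtCM ?nnegrE ?exprn_ge0//.
by rewrite sqrCK.
Qed.

Let L2norm0_eq0 (u : L2 mu) : L2norm u = 0 -> u = 0.
Proof. by move=> /eqP; rewrite sqrt_dnorm_eq0 => /eqP. Qed.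

HB.instance Definition _ := Lmodule_isNormed.Build R[i] (L2 mu)
  L2normD L2normZ L2norm0_eq0.

Lemma L2normE (u : L2 mu) : `|u| = sqrtC (L2dot u u).
Proof. by []. Qed.

End L2_norm.

Section adjoint.
Context {d : measure_display} {T : measurableType d} {R : realType}.
Variable mu : {measure set T -> \bar R}.

(* The B such that <A u, v> = <u, B v>; it is unique when it exists
   ([adjointE]), and exists for the shifts below ([adjoint_tf_shift]). *)
Definition adjoint (A : L2 mu -> L2 mu) : L2 mu -> L2 mu :=
  xget (fun=> 0) [set B | forall u v, L2dot (A u) v = L2dot u (B v)].

Lemma adjointE (A B : L2 mu -> L2 mu) :
  (forall u v, L2dot (A u) v = L2dot u (B v)) -> adjoint A = B.
Proof.
move=> AB; apply: xget_unique => // B' AB'; apply/funext => v.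
apply/eqP; rewrite -subr_eq0 -(dnorm_eq0 (@L2dot _ _ _ mu)).
by rewrite linearBr/= -AB -AB' subrr.
Qed.

End adjoint.

Section time_frequency_shift.
Context {R : realType} {n : nat}.
Local Notation mu := (lebesgue_rV R n).

Definition expi (t : R) : R[i] := cos t +i* sin t.

Lemma expiD s t : expi (s + t) = expi s * expi t.
Proof. by rewrite /expi cosD sinD; congr (_ +i* _); rewrite addrC. Qed.

Lemma conj_expi t : conjC (expi t) = expi (- t).
Proof. by rewrite -[LHS]/(cos t +i* - sin t) /expi cosN sinN. Qed.

Lemma normc_expiM t (z : R[i]) : Normc.normc (expi t * z) = Normc.normc z.
Proof. by rewrite Normc.normcM /= cos2Dsin2 sqrtr1 mul1r. Qed.

Definition tf_phase (xi y : 'rV[R]_n) : R := 2 * pi * \sum_i xi ord0 i * y ord0 i.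

(* pi(z) f (y) = e^{2 pi i xi . y} f(y - x) for z = (x, xi), on functions;
   [tf_shift] is the induced operator on L^2(R^n). *)
Definition tf_fun (z : 'rV[R]_n * 'rV[R]_n) (f : 'rV[R]_n -> R[i]) :
    'rV[R]_n -> R[i] :=
  fun y => expi (tf_phase z.2 y) * f (y - z.1).

Lemma measurable_tf_phase xi : measurable_fun setT (tf_phase xi).
Proof.
apply: measurable_funM => //.
apply: measurable_sum => i; apply: measurable_funM => //.
exact: measurable_coord.
Qed.

Lemma ge0_integral_rV_shift (x : 'rV[R]_n) (g : 'rV[R]_n -> \bar R) :
  measurable_fun setT g -> (forall y, 0 <= g y)%E ->
  (\int[mu]_y g (y - x)%R = \int[mu]_y g y)%E.
Proof.
move=> mg g0.
rewrite -[LHS](@ge0_integral_pushforward _ _ _ _ _ _ (measurable_shift x) mu setT)//.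
apply: eq_measure_integral => [|? A mA _]; [exact: measurable_shift|exact: lebesgue_rV_shift].
Qed.

Lemma tf_fun_L2 z (f : L2fun mu) : (tf_fun z f : _ -> R[i]^o) \in L2_pred mu.
Proof.
have [mR mI] := measurable_L2fun f; have := L2valP f; rewrite !inE /= => -[_ _ fin].
have mRx : measurable_fun setT (fun y : 'rV[R]_n => complex.Re (f (y - z.1)) : R).
  exact: (measurableT_comp mR (measurable_shift z.1)).
have mIx : measurable_fun setT (fun y : 'rV[R]_n => complex.Im (f (y - z.1)) : R).
  exact: (measurableT_comp mI (measurable_shift z.1)).
have mc : measurable_fun setT (fun y => cos (tf_phase z.2 y)).
  exact: (measurableT_comp (continuous_measurable_fun (@continuous_cos R)) (measurable_tf_phase z.2)).
have ms : measurable_fun setT (fun y => sin (tf_phase z.2 y)).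
  exact: (measurableT_comp (continuous_measurable_fun (@continuous_sin R)) (measurable_tf_phase z.2)).
split.
- rewrite (_ : (fun x => _) = fun y =>
    cos (tf_phase z.2 y) * complex.Re (f (y - z.1)) -
    sin (tf_phase z.2 y) * complex.Im (f (y - z.1))).
    by apply: measurable_funB; apply: measurable_funM.
  by apply/funext => y; rewrite /tf_fun; case: (L2val _ _).
- rewrite (_ : (fun x => _) = fun y =>
    cos (tf_phase z.2 y) * complex.Im (f (y - z.1)) +
    sin (tf_phase z.2 y) * complex.Re (f (y - z.1))).
    by apply: measurable_funD; apply: measurable_funM.
  by apply/funext => y; rewrite /tf_fun; case: (L2val _ _).
- under eq_integral do rewrite /tf_fun normc_expiM.
  rewrite (@ge0_integral_rV_shift z.1 (fun y => (Normc.normc (f y) ^+ 2)%:E))//.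
    apply/measurable_EFinP; under eq_fun do rewrite sqr_Re_normc.
    by apply: measurable_funD; exact: measurable_funX.
  by move=> y; rewrite lee_fin sqr_ge0.
Qed.

Definition tf_L2fun z (f : L2fun mu) : L2fun mu := MkL2fun (tf_fun_L2 z f).

Definition tf_shift z (u : L2 mu) : L2 mu := \pi_(L2 mu) (tf_L2fun z (repr u)).

Lemma tf_shiftE z (f : L2fun mu) :
  tf_shift z (\pi_(L2 mu) f) = \pi_(L2 mu) (tf_L2fun z f).
Proof.
apply/eq_L2P; have /eq_L2P [N [mN N0 fN]] := reprK (\pi_(L2 mu) f).
exists ((fun y => y - z.1) @^-1` N); split.
- by rewrite -[X in measurable X]setTI; exact: measurable_shift.
- by rewrite -N0; exact: lebesgue_rV_shift.
- move=> y /= h; apply: fN => /= e; apply: h.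
  by rewrite /tf_fun e.
Qed.

Let tf_shift_linear z : linear (tf_shift z).
Proof.
move=> a u v; rewrite -[u]reprK -[v]reprK -pi_L2Z -pi_L2D !tf_shiftE.
rewrite -pi_L2Z -pi_L2D; congr (\pi_(L2 mu) _); apply/val_inj/funext => y /=.
by rewrite /tf_fun /= !fctE mulrDr mulrCA.
Qed.

HB.instance Definition _ z := GRing.isLinear.Build R[i] (L2 mu) (L2 mu) _
  (tf_shift z) (tf_shift_linear z).

Lemma integral_rV_shift (x : 'rV[R]_n) (g : 'rV[R]_n -> \bar R) :
  measurable_fun setT g -> (\int[mu]_y g (y - x)%R = \int[mu]_y g y)%E.
Proof.
move=> mg; rewrite integralE [RHS]integralE; congr (_ - _)%E.
- rewrite -[RHS](@ge0_integral_rV_shift x g^\+%E).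
  + by apply: eq_integral => y _; rewrite !funeposE.
  + exact: measurable_funepos.
  + by move=> y; exact: funepos_ge0.
- rewrite -[RHS](@ge0_integral_rV_shift x g^\-%E).
  + by apply: eq_integral => y _; rewrite !funenegE.
  + exact: measurable_funeneg.
  + by move=> y; exact: funeneg_ge0.
Qed.

Lemma L2dot_tf_shift x xi (u v : L2 mu) :
  L2dot (tf_shift (x, xi) u) v =
  L2dot u (expi (- tf_phase xi x) *: tf_shift (- x, - xi) v).
Proof.
rewrite -[u]reprK -[v]reprK !tf_shiftE -pi_L2Z !L2dotE.
set f := repr u; set g := repr v.
have [mR mI] := integrable_L2mul (tf_L2fun (x, xi) f) g.
have E y : tf_L2fun (x, xi) f (y - (- x)) * conjC (g (y - (- x))) =
    f y * conjC ((expi (- tf_phase xi x) *: tf_L2fun (- x, - xi) g : L2fun mu) y).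
  rewrite /= !fctE /tf_fun /= opprK addrK.
  rewrite -[_ *: _]/(_ * _) !rmorphM /= !conj_expi.
  rewrite [expi _ * f y]mulrC.
  rewrite -!mulrA; congr (_ * _); rewrite mulrA -expiD; congr (expi _ * _).
  rewrite /tf_phase opprK -mulrN -mulrDr; congr (_ * _).
  rewrite -sumrN -big_split /=; apply: eq_bigr => i _.
  by rewrite !mxE mulrDr mulNr opprK addrC.
rewrite /cintegral; congr (_ +i* _); congr fine.
- rewrite -(@integral_rV_shift (- x)); last exact: (measurable_int mu mR).
  by apply: eq_integral => y _; rewrite /= -E.
- rewrite -(@integral_rV_shift (- x)); last exact: (measurable_int mu mI).
  by apply: eq_integral => y _; rewrite /= -E.
Qed.

Lemma adjoint_tf_shift x xi : adjoint (tf_shift (x, xi)) =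
  fun v : L2 mu => expi (- tf_phase xi x) *: tf_shift (- x, - xi) v.
Proof. by apply: adjointE => u v; exact: L2dot_tf_shift. Qed.

End time_frequency_shift.

Section operators.
Context {K : numFieldType} {U V : normedModType K}.

Definition bounded_operator (S : U -> V) : Prop :=
  exists M : K, forall u, `|S u| <= M * `|u|.

Definition compact_operator (S : U -> V) : Prop :=
  precompact (S @` [set u | `|u| <= 1]).

End operators.

Section B_pt.
Variables (R : realType) (d : nat).

Local Notation L2Rd := (L2 (lebesgue_rV R d)).

Definition alpha (z : 'rV[R]_d * 'rV[R]_d) (S : L2Rd -> L2Rd) : L2Rd -> L2Rd :=
  tf_shift z \o S \o adjoint (tf_shift z).

Definition Q (S : L2Rd -> L2Rd) (f : L2Rd) (z : 'rV[R]_d * 'rV[R]_d) : R[i] :=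
  L2dot (alpha z S f) f.

(* By Riesz, testing against inner products is testing against all bounded
   functionals. *)
Definition weak_cvg (f_ : nat -> L2Rd) (f : L2Rd) : Prop :=
  forall g : L2Rd, (fun n => L2dot (f_ n) g) @ \oo --> L2dot f g.

Definition B_pt : set {linear L2Rd -> L2Rd} := [set S |
  bounded_operator S /\
  forall (f_ : nat -> L2Rd) (f : L2Rd), weak_cvg f_ f ->
    forall z, (fun n => Q S (f_ n) z) @ \oo --> Q S f z].

Definition compact_operators : set {linear L2Rd -> L2Rd} :=
  [set S | compact_operator S].

End B_pt.
Arguments B_pt : clear implicits.
Arguments compact_operators : clear implicits.

(* Main.v *)
(* Key dichotomy for a linear S on L^2 and eps > 0: either some finite orthonormal
   family F satisfies |S x| <= eps |x| for all x orthogonal to F, or there is an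
   orthonormal sequence e_n with |S e_n| > eps.  By Bessel's inequality, S e_n tends
   weakly to 0 as soon as S is bounded.

   If S is compact, S e_n has a norm cluster point, which must be 0, so the first case
   holds for every eps; hence S maps bounded weakly null sequences to norm null ones.
   Weakly convergent sequences are bounded (uniform boundedness), so <S f_n, f_n>
   converges, and Q_S f(z) = <S (pi(z)^* f), pi(z)^* f> is of this form.

   If S is in B_pt, polarization at z = 0 along the weakly null sequences
   e_n + i^k S e_n gives |S e_n|^2 -> 0, so again the first case holds for every eps;
   S is then approximated on the unit ball by maps with compact image, and is compact
   since L^2 is complete.  Neither the Riesz representation theorem nor weak
   compactness of the ball is needed. *)
Require Import Defs.
From mathcomp Require Import all_boot all_classical all_reals.
From mathcomp Require Import all_order all_algebra sesquilinear all_analysis.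
From mathcomp Require Import measurable_realfun complex ring lra.
Set Implicit Arguments.
Unset Strict Implicit.
Unset Printing Implicit Defensive.
Import Order.TTheory GRing.Theory Num.Def Num.Theory.
Import numFieldNormedType.Exports.

Local Open Scope classical_set_scope.
Local Open Scope ring_scope.
Local Open Scope quotient_scope.
Local Open Scope complex_scope.

Local Notation normc := Normc.normc.

Local Arguments L2dot : simpl never.

Local Arguments Normc.normc : simpl never.

(** * Real-valued modulus on [R[i]] and convergence of complex sequences *)

Section complex_modulus.
Variable R : realType.
Implicit Types z w : R[i].

Lemma normcC z : `|z| = (normc z)%:C.
Proof. by rewrite normc_def; case: z => a b. Qed.

Lemma normc_ge0 z : 0 <= normc z.
Proof. by rewrite -ler0c -normcC. Qed.

Lemma normcD z w : normc (z + w) <= normc z + normc w.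
Proof. by rewrite -lecR rmorphD/= -!normcC ler_normD. Qed.

Lemma normc_conj z : normc (conjC z) = normc z.
Proof. by case: z => a b; rewrite /Normc.normc /= sqrrN. Qed.

Lemma normc_real (a : R) : normc a%:C = `|a|.
Proof. by rewrite /Normc.normc /= expr0n addr0 sqrtr_sqr. Qed.

Lemma abs_Re_le z : `|complex.Re z| <= normc z.
Proof. by rewrite -lecR -normcC; exact: normc_ge_Re. Qed.

Lemma abs_Im_le z : `|complex.Im z| <= normc z.
Proof.
rewrite -(ler_pXn2r (n := 2)) ?nnegrE ?normc_ge0//.
by rewrite sqr_Re_normc real_normK ?num_real// lerDr sqr_ge0.
Qed.

(** A positive element of [R[i]] is real, so the complex tolerance in the definition of the limit
    can be traded for a real one, on which real arithmetic is available. *)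
Lemma cvgcP (u : nat -> R[i]) (l : R[i]) :
  u @ \oo --> l <-> forall e : R, 0 < e -> \forall n \near \oo, normc (u n - l) < e.
Proof.
have nb n : normc (u n - l) = normc (l - u n).
  by apply: complexI; rewrite -!normcC distrC.
split=> [/cvgrPdist_lt ul e e0|H].
  have : 0 < e%:C by rewrite ltcR.
  by move=> /ul; apply: filterS => n; rewrite normcC ltcR nb.
apply/cvgrPdist_lt => e e0; have eE : e = (complex.Re e)%:C by rewrite RRe_real// gtr0_real.
rewrite eE ltcR in e0; have := H _ e0.
by apply: filterS => n; rewrite eE normcC ltcR nb.
Qed.

Lemma cvgc_bounded (u : nat -> R[i]) (l : R[i]) :
  u @ \oo --> l -> exists M : R, forall n, normc (u n) <= M.
Proof.
move=> /cvgcP/(_ _ ltr01)[N _ NP].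
(* The finite sum dominates the terms before [N]; [normc l + 1] handles the others. *)
exists (normc l + 1 + \sum_(i < N) normc (u i)) => n.
have S0 : 0 <= \sum_(i < N) normc (u i) by apply: sumr_ge0 => i _; exact: normc_ge0.
have [nN|Nn] := ltnP n N.
  rewrite (bigD1 (Ordinal nN))//= addrCA lerDl !addr_ge0 ?normc_ge0//.
  by apply: sumr_ge0 => i _; exact: normc_ge0.
have /= ul := NP n Nn; have := normcD (u n - l) l; rewrite subrK; lra.
Qed.

Lemma normc_nat n : normc (n%:R : R[i]) = n%:R.
Proof. by rewrite -[n%:R in LHS](rmorph_nat (real_complex R)) normc_real normr_nat. Qed.

End complex_modulus.

(** * Real-valued norm on [L2] and the calculus of its inner product *)

Section L2_real_norm.
Context {d : measure_display} {T : measurableType d} {R : realType}.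
Variable mu : {measure set T -> \bar R}.
Implicit Types u v w : L2 mu.

(** The norm of [L2] takes values in [R[i]]; its real part loses nothing by [rnormC] and makes
    estimates accessible to real arithmetic. *)
Definition rnorm u : R := complex.Re `|u|.

Lemma rnormC u : `|u| = (rnorm u)%:C.
Proof. by rewrite /rnorm RRe_real// ger0_real. Qed.

Lemma rnorm_ge0 u : 0 <= rnorm u.
Proof. by rewrite -ler0c -rnormC. Qed.

Lemma rnormD u v : rnorm (u + v) <= rnorm u + rnorm v.
Proof. by rewrite -lecR rmorphD/= -!rnormC ler_normD. Qed.

Lemma rnormZ a u : rnorm (a *: u) = normc a * rnorm u.
Proof. by apply: complexI; rewrite rmorphM/= -!rnormC normrZ normcC. Qed.

Lemma rnormN u : rnorm (- u) = rnorm u.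
Proof. by rewrite /rnorm normrN. Qed.

Lemma rdistC u v : rnorm (u - v) = rnorm (v - u).
Proof. by rewrite /rnorm distrC. Qed.

Lemma rnorm0 : rnorm 0 = 0.
Proof. by rewrite /rnorm normr0. Qed.

Lemma rnorm0_eq0 u : rnorm u = 0 -> u = 0.
Proof. by move=> u0; apply/normr0_eq0; rewrite rnormC u0. Qed.

Lemma rdist_triangle w u v : rnorm (u - v) <= rnorm (u - w) + rnorm (w - v).
Proof. by apply: le_trans (rnormD _ _); rewrite addrA subrK. Qed.

Lemma rnorm_sum (I : Type) (r : seq I) (F : I -> L2 mu) :
  rnorm (\sum_(i <- r) F i) <= \sum_(i <- r) rnorm (F i).
Proof.
elim/big_ind2: _ => [|x y z w xy zw|//]; first by rewrite rnorm0.
exact: le_trans (rnormD _ _) (lerD xy zw).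
Qed.

Lemma L2dot_rnorm u : L2dot u u = (rnorm u ^+ 2)%:C.
Proof. by rewrite rmorphXn/= -rnormC L2normE sqrtCK. Qed.

Lemma L2dotC u v : L2dot u v = conjC (L2dot v u).
Proof. by rewrite (hermC (@L2dot _ _ _ mu)) expr0 mul1r. Qed.

Lemma L2dotDl u v w : L2dot (u + v) w = L2dot u w + L2dot v w.
Proof. exact: linearDl. Qed.

Lemma L2dotBl u v w : L2dot (u - v) w = L2dot u w - L2dot v w.
Proof. exact: linearBl. Qed.

Lemma L2dotNl u v : L2dot (- u) v = - L2dot u v.
Proof. exact: linearNl. Qed.

Lemma L2dotZl a u v : L2dot (a *: u) v = a * L2dot u v.
Proof. exact: linearZl_LR. Qed.

Lemma L2dot0l v : L2dot (0 : L2 mu) v = 0.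
Proof. exact: linear0l. Qed.

Lemma L2dot_suml (I : Type) (r : seq I) (F : I -> L2 mu) v :
  L2dot (\sum_(i <- r) F i) v = \sum_(i <- r) L2dot (F i) v.
Proof. by elim/big_rec2: _ => [|i y x _ <-]; rewrite ?L2dot0l ?L2dotDl. Qed.

Lemma L2dotDr u v w : L2dot u (v + w) = L2dot u v + L2dot u w.
Proof. by rewrite !(L2dotC u) L2dotDl rmorphD. Qed.

Lemma L2dotNr u v : L2dot u (- v) = - L2dot u v.
Proof. by rewrite !(L2dotC u) L2dotNl rmorphN. Qed.

Lemma L2dotBr u v w : L2dot u (v - w) = L2dot u v - L2dot u w.
Proof. by rewrite !(L2dotC u) L2dotBl rmorphB. Qed.

Lemma L2dotZr a u v : L2dot u (a *: v) = conjC a * L2dot u v.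
Proof. by rewrite !(L2dotC u) L2dotZl rmorphM. Qed.

Lemma L2dot_sumr (I : Type) (r : seq I) (F : I -> L2 mu) u :
  L2dot u (\sum_(i <- r) F i) = \sum_(i <- r) L2dot u (F i).
Proof.
rewrite L2dotC L2dot_suml rmorph_sum; apply: eq_bigr => i _.
by rewrite [RHS]L2dotC.
Qed.

Lemma L2dot_le u v : normc (L2dot u v) <= rnorm u * rnorm v.
Proof.
rewrite -(ler_pXn2r (n := 2)) ?nnegrE ?mulr_ge0 ?normc_ge0 ?rnorm_ge0//.
rewrite -lecR rmorphXn/= -normcC exprMn rmorphM/= -!L2dot_rnorm.
exact: dot_CauchySchwarz.
Qed.

Lemma L2dot_cvg_sub (f_ : nat -> L2 mu) f g :
  (fun n => L2dot (f_ n) g) @ \oo --> L2dot f g <->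
  (fun n => L2dot (f_ n - f) g) @ \oo --> (0 : R[i]).
Proof.
by rewrite !cvgcP; split => H e /H; apply: filterS => n; rewrite subr0 L2dotBl.
Qed.

End L2_real_norm.

(** * Scalar sequences with geometrically small increments *)

Lemma cvg_half_exprn (R : realType) : (fun k => 2^-1 ^+ k) @ \oo --> (0 : R).
Proof. by apply: cvg_expr; rewrite ger0_norm ?invr_ge0// invf_lt1// ltr1n. Qed.

(** The brackets [c] and [b], at distance [2 * M * 2^-1 ^+ k] below and above [a k], are
    nondecreasing and nonincreasing. Monotone convergence of [c] gives the limit, and the brackets
    give the error bound. *)
Lemma geometric_cauchy_cvg (R : realType) (a : nat -> R) (M : R) :
  (forall k, `|a k.+1 - a k| <= M * 2^-1 ^+ k) ->
  exists2 l, a @ \oo --> l & forall k, `|l - a k| <= 2 * M * 2^-1 ^+ k.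
Proof.
move=> aM; pose c k := a k - 2 * M * 2^-1 ^+ k; pose b k := a k + 2 * M * 2^-1 ^+ k.
have M0 : 0 <= M by have := aM 0; rewrite expr0 mulr1; exact: le_trans.
have M2 k : 0 <= M * 2^-1 ^+ k by rewrite mulr_ge0// exprn_ge0.
have ndc : nondecreasing_seq c.
  apply/nondecreasing_seqP => k; rewrite /c exprS.
  by have := aM k; have := M2 k; rewrite ler_norml => ? /andP[? ?]; lra.
have nib : nonincreasing_seq b.
  apply/nonincreasing_seqP => k; rewrite /b exprS.
  by have := aM k; have := M2 k; rewrite ler_norml => ? /andP[? ?]; lra.
have cb k n : c k <= b n.
  apply: (@le_trans _ _ (c (maxn k n))); first by rewrite ndc// leq_maxl.
  apply: (@le_trans _ _ (b (maxn k n))); last by rewrite nib// leq_maxr.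
  by rewrite /c /b; have := M2 (maxn k n); lra.
have cc : cvgn c.
  apply: nondecreasing_is_cvgn => //; exists (b 0) => _ [k _ <-]; exact: cb.
exists (limn c).
  rewrite (_ : a = c + (fun k => 2 * M * 2^-1 ^+ k)); last first.
    by apply/funext => k; rewrite !fctE /c subrK.
  rewrite -[limn c]addr0; apply: cvgD => //.
  rewrite -[X in _ --> X](mulr0 (2 * M)); apply: cvgMl_tmp.
  exact: cvg_half_exprn.
move=> k; rewrite ler_norml; apply/andP; split.
  by have := nondecreasing_cvgn_le ndc cc k; rewrite {1}/c; lra.
by rewrite lerBlDl; apply: limr_le => //; apply: nearW => n; exact: cb.
Qed.

(** The real case applies to each component; two errors of constant 2 combine to at most 2 sqrt 2,
    rounded up to 4. Convergence is kept componentwise because measurability is. *)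
Lemma geometric_ccauchy_cvg (R : realType) (z : nat -> R[i]) (M : R) :
  (forall k, normc (z k.+1 - z k) <= M * 2^-1 ^+ k) ->
  exists l : R[i], [/\ (fun k => complex.Re (z k)) @ \oo --> complex.Re l,
    (fun k => complex.Im (z k)) @ \oo --> complex.Im l &
    forall k, normc (l - z k) <= 4 * M * 2^-1 ^+ k].
Proof.
move=> zM.
have [k|p zp pM] := @geometric_cauchy_cvg R (fun k => complex.Re (z k)) M.
  by apply: le_trans (zM k); rewrite -raddfB; exact: abs_Re_le.
have [k|q zq qM] := @geometric_cauchy_cvg R (fun k => complex.Im (z k)) M.
  by apply: le_trans (zM k); rewrite -raddfB; exact: abs_Im_le.
exists (p +i* q); split=> // k.
rewrite -(ler_pXn2r (n := 2)) ?nnegrE ?normc_ge0//; last first.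
  have := pM k; have := normr_ge0 (p - complex.Re (z k)); lra.
have {pM} := pM k; have {qM} := qM k.
rewrite sqr_Re_normc; case: (z k) => a b /=.
by rewrite !ler_norml => /andP[? ?] /andP[? ?]; nra.
Qed.

(** * Completeness of [L2] for geometrically Cauchy sequences *)

Section riesz_fischer.
Context {d : measure_display} {T : measurableType d} {R : realType}.
Variable mu : {measure set T -> \bar R}.

Lemma measurable_normc2 (f : T -> R[i]) :
  measurable_fun setT (fun x => complex.Re (f x)) ->
  measurable_fun setT (fun x => complex.Im (f x)) ->
  measurable_fun setT (fun x => (normc (f x) ^+ 2)%:E).
Proof.
move=> mR mI; apply/measurable_EFinP; under eq_fun do rewrite sqr_Re_normc.
by apply: measurable_funD; exact: measurable_funX.
Qed.

Lemma rnorm_piE (f : L2fun mu) :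
  (rnorm (\pi_(L2 mu) f) ^+ 2)%:E = (\int[mu]_x (normc (f x) ^+ 2)%:E)%E.
Proof.
have := L2dot_normc f; rewrite L2dot_rnorm => /complexI ->.
rewrite /Rintegral fineK// ge0_fin_numE; last first.
  by apply: integral_ge0 => x _; rewrite lee_fin sqr_ge0.
by have := L2valP f; rewrite inE => -[].
Qed.

(* With Phi = sum_k 4^k |g_(k+1) - g_k|^2, integrable by hypothesis, one has
   |g_(k+1) - g_k| <= 2^-k sqrt Phi pointwise, which gives both the pointwise limit
   where Phi < +oo and the domination of its distance to g_k; where Phi = +oo the
   domination is trivial, so no almost-everywhere argument is needed. *)
Lemma riesz_fischer_geometric (u : nat -> L2 mu) :
  (forall k, rnorm (u k.+1 - u k) <= 8^-1 ^+ k) ->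
  exists v C, forall k, rnorm (v - u k) <= C * 2^-1 ^+ k.
Proof.
move=> uE.
pose g k := repr (u k).
have gE k : \pi_(L2 mu) (g k) = u k by exact: reprK.
have piB (f h : L2fun mu) : \pi_(L2 mu) (f - h) = \pi_(L2 mu) f - \pi_(L2 mu) h.
  exact: raddfB.
pose F k x : \bar R := (4 ^+ k * normc (g k.+1 x - g k x) ^+ 2)%:E.
have F0 k x : (0 <= F k x)%E by rewrite lee_fin mulr_ge0 ?sqr_ge0 ?exprn_ge0.
have mB (f h : L2fun mu) : measurable_fun setT (fun x => (normc (f x - h x) ^+ 2)%:E).
  by have [mR mI] := measurable_L2fun (f - h); exact: measurable_normc2.
have mF k : measurable_fun setT (F k).
  rewrite (_ : F k = fun x => (4 ^+ k)%:E * (normc (g k.+1 x - g k x) ^+ 2)%:E)%E//.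
  by apply: measurable_funeM; exact: mB.
pose Phi x := (\sum_(k <oo) F k x)%E.
have mPhi : measurable_fun setT Phi by exact: ge0_emeasurable_sum.
have Phi0 x : (0 <= Phi x)%E by exact: nneseries_ge0.
have FPhi k x : (F k x <= Phi x)%E.
  apply: le_trans (nneseries_lim_ge k.+1 _); last by move=> i _ _; exact: F0.
  by rewrite big_nat_recr//= leeDr// sume_ge0.
have intPhi : (\int[mu]_x Phi x <= 2%:E)%E.
  rewrite integral_nneseries//; apply: lime_le.
    by apply: is_cvg_nneseries => k _ _; exact: integral_ge0.
  apply: nearW => n; apply: (@le_trans _ _ (\sum_(0 <= k < n) 2^-1 ^+ k)%:E).
    rewrite -sumEFin.
    apply: lee_sum => k _; under eq_integral do rewrite /F EFinM.
    rewrite ge0_integralZl_EFin ?exprn_ge0//; last first.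
      by move=> x _; rewrite lee_fin sqr_ge0.
    rewrite -(rnorm_piE (g k.+1 - g k)) piB !gE -EFinM lee_fin.
    (* The weight 4^k is absorbed by the squared increments: 4^k 64^-k = 16^-k, at most 2^-k, whose
       partial sums stay below 2. *)
    apply: (@le_trans _ _ (4 ^+ k * (8^-1 ^+ k) ^+ 2)).
      by rewrite ler_wpM2l ?exprn_ge0// ler_pXn2r ?nnegrE ?rnorm_ge0 ?exprn_ge0.
    rewrite -exprM mulnC exprM -exprMn; apply: lerXn2r; rewrite ?nnegrE ?invr_ge0//; last by lra.
  rewrite lee_fin.
  suff -> : \sum_(0 <= k < n) 2^-1 ^+ k = 2 - 2 * 2^-1 ^+ n :> R.
    by rewrite gerBl mulr_ge0 ?exprn_ge0.
  elim: n => [|n IH]; first by rewrite big_geq// expr0 mulr1 subrr.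
  by rewrite big_nat_recr//= IH exprS; field.
pose P x := Num.sqrt (fine (Phi x)).
have PE x : (Phi x < +oo)%E -> ((P x ^+ 2)%:E = Phi x)%E.
  move=> Px; rewrite /P sqr_sqrtr ?fine_ge0// fineK//.
  by rewrite ge0_fin_numE.
(* Setting the sequence to 0 where [Phi] is infinite makes it converge at every point, so that [L]
   is measurable as a pointwise limit. *)
pose g0 k x : R[i] := if (Phi x < +oo)%E then g k x else 0.
have /choice[L LP] (x : T) : exists l : R[i],
    [/\ (fun k => complex.Re (g0 k x)) @ \oo --> complex.Re l,
    (fun k => complex.Im (g0 k x)) @ \oo --> complex.Im l &
    (Phi x < +oo)%E -> forall k, normc (l - g k x) <= 4 * P x * 2^-1 ^+ k].
  rewrite /g0; case: ltP => Px; last by exists 0; split => //; exact: cvg_cst.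
  have [k|l [l1 l2 l3]] := @geometric_ccauchy_cvg R (fun k => g k x) (P x).
    rewrite -(ler_pXn2r (n := 2)) ?nnegrE ?normc_ge0 ?mulr_ge0 ?exprn_ge0 ?sqrtr_ge0//.
    have := FPhi k x; rewrite -(PE _ Px) lee_fin exprMn -exprM mulnC exprM.
    have e4 : (2^-1 : R) ^+ 2 = 4^-1 by field.
    by rewrite e4 exprVn ler_pdivlMr ?exprn_gt0// mulrC.
  by exists l.
have mL : measurable_fun setT (fun x => complex.Re (L x)) /\
          measurable_fun setT (fun x => complex.Im (L x)).
  have mP : measurable_fun setT (fun x => (Phi x < +oo)%E).
    exact: measurable_fun_lte.
  split; [apply: (@measurable_fun_cvg _ _ _ _ (fun k x => complex.Re (g0 k x))) |
          apply: (@measurable_fun_cvg _ _ _ _ (fun k x => complex.Im (g0 k x)))].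
  - move=> k; rewrite /g0 (_ : (fun x => _) =
      fun x => if (Phi x < +oo)%E then complex.Re (g k x) else 0).
      by apply: measurable_fun_ifT => //; have [] := measurable_L2fun (g k).
    by apply/funext => x; case: ifP.
  - by move=> x _; have [] := LP x.
  - move=> k; rewrite /g0 (_ : (fun x => _) =
      fun x => if (Phi x < +oo)%E then complex.Im (g k x) else 0).
      by apply: measurable_fun_ifT => //; have [] := measurable_L2fun (g k).
    by apply/funext => x; case: ifP.
  - by move=> x _; have [] := LP x.
have mLg k : measurable_fun setT (fun x => complex.Re (L x - g k x)) /\
             measurable_fun setT (fun x => complex.Im (L x - g k x)).
  have [m1 m2] := mL; have [n1 n2] := measurable_L2fun (g k).
  split; under eq_fun do rewrite raddfB/=; exact: measurable_funB.
(* Since [Phi] has integral at most 2, the dominating function integrates to at most 32 * 4^-k,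
   rounded up to the square 64 * 4^-k. *)
have intL k : (\int[mu]_x (normc (L x - g k x) ^+ 2)%:E <=
               ((8 * 2^-1 ^+ k) ^+ 2)%:E)%E.
  apply: (@le_trans _ _ (\int[mu]_x (((4 * 2^-1 ^+ k) ^+ 2)%:E * Phi x))%E).
    have [m1 m2] := mLg k.
    apply: ge0_le_integral => //.
    - by move=> x _; rewrite lee_fin sqr_ge0.
    - exact: measurable_normc2.
    - exact: measurable_funeM.
    move=> x _; have [Px|Px] := ltP (Phi x) +oo%E; last first.
      have PxE : Phi x = +oo%E by apply/eqP; rewrite -leye_eq.
      by rewrite PxE gt0_muley ?leey// lte_fin exprn_gt0// mulr_gt0// exprn_gt0.
    have [_ _ /(_ Px k) Lx] := LP x.
    rewrite -(PE _ Px) -EFinM lee_fin -exprMn ler_pXn2r ?nnegrE ?normc_ge0//.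
      by rewrite mulrAC.
    by rewrite !mulr_ge0 ?exprn_ge0 ?sqrtr_ge0.
  rewrite ge0_integralZl_EFin ?sqr_ge0//.
  apply: (@le_trans _ _ (((4 * 2^-1 ^+ k) ^+ 2)%:E * 2%:E)%E).
    by apply: lee_wpmul2l => //; rewrite lee_fin sqr_ge0.
  rewrite -EFinM lee_fin !exprMn mulrAC ler_wpM2r ?sqr_ge0//; lra.
have Lg0 : ((fun x => L x - g 0 x) : T -> R[i]^o) \in L2_pred mu.
  have [m1 m2] := mLg 0; rewrite inE; split => //.
  exact: le_lt_trans (intL 0) (ltry _).
(* Square integrability has been shown for [L - g 0] rather than for [L], so the limit class is
   built from that difference. *)
exists (\pi_(L2 mu) (MkL2fun Lg0) + u 0), 8 => k.
rewrite -(gE 0) -(gE k) -pi_L2D -piB.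
rewrite -(ler_pXn2r (n := 2)) ?nnegrE ?rnorm_ge0 ?mulr_ge0 ?exprn_ge0//.
rewrite -lee_fin rnorm_piE; apply: le_trans (intL k).
under eq_integral do rewrite /= !fctE /= subrK.
by [].
Qed.

(** Passing through [u (k + n)] and letting n grow replaces the unspecified constant by the
    geometric tail 8/7. The gliding hump relies on this: after step k the remaining displacement is
    at most 1/7 of 8^-k. *)
Lemma riesz_fischer (u : nat -> L2 mu) :
  (forall k, rnorm (u k.+1 - u k) <= 8^-1 ^+ k) ->
  exists v, forall k, rnorm (v - u k) <= 8 / 7 * 8^-1 ^+ k.
Proof.
move=> uE; have [v [C vC]] := riesz_fischer_geometric uE; exists v => k.
have tail n : rnorm (u (k + n)%N - u k) <= 8 / 7 * 8^-1 ^+ k.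
  suff : rnorm (u (k + n)%N - u k) <= 8 / 7 * (8^-1 ^+ k - 8^-1 ^+ (k + n)%N).
    by move=> /le_trans -> //; rewrite ler_wpM2l ?divr_ge0// gerBl exprn_ge0.
  elim: n => [|n IH]; first by rewrite addn0 !subrr rnorm0 mulr0.
  rewrite addnS; apply: le_trans (rdist_triangle (u (k + n)%N) _ _) _.
  apply: le_trans (lerD (uE _) IH) _; rewrite exprS.
  by rewrite le_eqVlt; apply/orP; left; apply/eqP; field.
apply/ler_addgt0Pl => e e0.
have /cvgrPdist_lt/(_ e e0) : (fun n => C * 2^-1 ^+ n) @ \oo --> (0 : R).
  rewrite -[X in _ --> X](mulr0 C); apply: cvgMl_tmp.
  exact: cvg_half_exprn.
move=> [n _ nP]; have := nP (k + n)%N (leq_addl _ _).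
rewrite sub0r normrN => Ce; apply: le_trans (rdist_triangle (u (k + n)%N) _ _) _.
by apply: lerD => //; apply: le_trans (vC _) (le_trans (ler_norm _) (ltW Ce)).
Qed.

End riesz_fischer.

(** * Weakly bounded sequences are norm bounded *)

Section uniform_boundedness.
Context {d : measure_display} {T : measurableType d} {R : realType}.
Variable mu : {measure set T -> \bar R}.

(** With [e] the multiple of [phi] of norm [c], the values at [x + e] and [x - e] differ by 2 c
    |phi|, so one of them has modulus at least c |phi|. *)
Lemma uniform_boundedness_step (phi x : L2 mu) (c : R) : 0 <= c ->
  exists y, rnorm (y - x) <= c /\ c * rnorm phi <= normc (L2dot y phi).
Proof.
move=> c0; have [->|phi0] := eqVneq phi 0.
  by exists x; rewrite subrr !rnorm0 mulr0 normc_ge0.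
have r0 : 0 < rnorm phi.
  rewrite lt_neqAle rnorm_ge0 andbT eq_sym; apply: contra_neq phi0.
  exact: rnorm0_eq0.
pose e := (c / rnorm phi)%:C *: phi.
have re : rnorm e = c.
  by rewrite rnormZ normc_real ger0_norm ?divfK ?gt_eqF// divr_ge0// ltW.
have ephi : L2dot e phi = (c * rnorm phi)%:C.
  rewrite L2dotZl L2dot_rnorm -[LHS]rmorphM/=; congr (_%:C).
  by field; rewrite gt_eqF.
have sum2 : 2 * (c * rnorm phi) <= normc (L2dot (x + e) phi) + normc (L2dot (x - e) phi).
  have -> : 2 * (c * rnorm phi) = normc (L2dot (x + e) phi - L2dot (x - e) phi).
    rewrite -L2dotBl opprB addrC addrA subrK. rewrite L2dotDl ephi -rmorphD normc_real.
    by rewrite ger0_norm ?addr_ge0 ?mulr_ge0 ?rnorm_ge0//; ring.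
  apply: le_trans (normcD _ _) _.
  by rewrite -[X in _ + X <= _](normcN (_ : Rcomplex R)) opprK.
have [h|h] := lerP (c * rnorm phi) (normc (L2dot (x + e) phi)).
  by exists (x + e); rewrite addrAC subrr add0r re.
exists (x - e); rewrite addrAC subrr add0r rnormN re; split => //; lra.
Qed.

(* Gliding hump: x is the limit of steps of size 8^-k, each chosen so that
   |<x, f_(n k)>| >= (6/7) 8^-k |f_(n k)|, where |f_(n k)| >= 16^k. *)
Lemma uniform_boundedness (f : nat -> L2 mu) :
  (forall g, exists M : R, forall n, normc (L2dot (f n) g) <= M) ->
  exists M : R, forall n, rnorm (f n) <= M.
Proof.
move=> fb; apply: contrapT => nb.
have /choice[n_ nP] (k : nat) : exists n, 16 ^+ k < rnorm (f n).
  apply: contrapT => h; apply: nb; exists (16 ^+ k) => n.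
  by rewrite leNgt; apply/negP => ?; apply: h; exists n.
have /choice[s sP] (p : nat * L2 mu) : exists y, rnorm (y - p.2) <= 8^-1 ^+ p.1 /\
    8^-1 ^+ p.1 * rnorm (f (n_ p.1)) <= normc (L2dot y (f (n_ p.1))).
  by apply: uniform_boundedness_step; rewrite exprn_ge0.
pose x := fix x k := if k is j.+1 then s (j, x j) else 0 : L2 mu.
have [k|v vP] := @riesz_fischer _ _ _ mu x; first by have [] := sP (k, x k).
have [M MP] := fb v.
have {}vP k : 6 / 7 * 2 ^+ k <= M.
  set y := f (n_ k); apply: le_trans (MP (n_ k)); rewrite -/y.
  rewrite L2dotC normc_conj.
  have /= [_ xy] := sP (k, x k); rewrite -/(x k.+1) -/y in xy.
  (* The factor 1/7 is 8/7 * 8^-1, the distance bound from [v] taken at index [k.+1]. *)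
  have e1 : normc (L2dot (x k.+1) y) <= normc (L2dot v y) + 7^-1 * 8^-1 ^+ k * rnorm y.
    rewrite -[x k.+1](subrK v) L2dotDl addrC.
    apply: le_trans (normcD _ _) _; rewrite lerD2l.
    apply: le_trans (L2dot_le _ _) _; rewrite ler_wpM2r ?rnorm_ge0// rdistC.
    by apply: le_trans (vP k.+1) _; rewrite exprS le_eqVlt; apply/orP; left; apply/eqP; field.
  have e2 : 2 ^+ k <= 8^-1 ^+ k * rnorm y.
    have -> : (2 : R) ^+ k = 8^-1 ^+ k * 16 ^+ k.
      by rewrite -exprMn; congr (_ ^+ _); field.
    by rewrite ler_wpM2l ?exprn_ge0// ltW// nP.
  by rewrite -mulrA in e1; lra.
have /= := archi_boundP (le_trans (mulr_ge0 _ (exprn_ge0 0 _)) (vP 0)).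
move=> /(_ ltac:(lra) ltac:(lra)); set k := Num.bound _ => Mk.
have k2 : k%:R < (2 : R) ^+ k by rewrite -natrX ltr_nat ltn_expl.
(* The index [k.+1] compensates the factor 6/7: 12/7 * 2^k exceeds 2^k, hence [M]. *)
have := vP k.+1; rewrite exprS; have : 0 <= (2 : R) ^+ k by rewrite exprn_ge0.
lra.
Qed.

End uniform_boundedness.

(** * Orthonormal families, projections and the dichotomy *)

Section orthonormal_sequences.
Context {d : measure_display} {T : measurableType d} {R : realType}.
Variable mu : {measure set T -> \bar R}.
Implicit Types (x g : L2 mu) (s : seq (L2 mu)).

Definition orthonormal (e : nat -> L2 mu) :=
  forall i j, L2dot (e i) (e j) = (i == j)%:R.

Definition rbounded (S : L2 mu -> L2 mu) (C : R) :=
  forall u, rnorm (S u) <= C * rnorm u.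

(* Bessel's inequality for the bounded functional u |-> <S u, g>; stating it this
   way avoids the adjoint of S. *)
Lemma orthonormal_weak0 (S : {linear L2 mu -> L2 mu}) (C : R) e g :
  rbounded S C -> orthonormal e ->
  (fun n => L2dot (S (e n)) g) @ \oo --> (0 : R[i]).
Proof.
move=> SC oe; pose c i := L2dot (S (e i)) g.
(* With these coefficients both |x n|^2 and <S (x n), g> equal [sigma n]; Cauchy-Schwarz then yields
   sigma^2 <= K sigma, so the partial sums are bounded by [K]. *)
pose x n := \sum_(i < n) conjC (c i) *: e i.
pose sigma := series (fun i => normc (c i) ^+ 2).
have sigma0 n : 0 <= sigma n by apply: sumr_ge0 => i _; exact: sqr_ge0.
have xe n j : (n <= j)%N -> L2dot (x n) (e j) = 0.
  move=> nj; rewrite L2dot_suml big1// => i _.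
  by rewrite L2dotZl oe ltn_eqF ?mulr0// (leq_trans (ltn_ord i)).
have xx n : rnorm (x n) ^+ 2 = sigma n.
  apply: complexI; rewrite -L2dot_rnorm.
  elim: n => [|n IH]; first by rewrite /x big_ord0 L2dot0l /sigma /series /= big_geq.
  rewrite /sigma seriesS -/sigma rmorphD/= -IH /x big_ord_recr/= -/(x n).
  rewrite L2dotDl !L2dotDr !L2dotZl !L2dotZr [L2dot (e n) (x n)]L2dotC.
  rewrite !xe// rmorph0 !mulr0 addr0 add0r oe eqxx mulr1 conjCK addrC; congr (_ + _).
  by rewrite mulrC -normCK normcC rmorphXn.
have Sx n : L2dot (S (x n)) g = (sigma n)%:C.
  rewrite linear_sum L2dot_suml /sigma /series/= big_mkord rmorph_sum/=.
  apply: eq_bigr => i _; rewrite linearZ L2dotZl -/(c i).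
  by rewrite mulrC -normCK normcC rmorphXn.
pose K := (C * rnorm g) ^+ 2.
have sigmaK n : sigma n <= K.
  have [s0|s0] := eqVneq (sigma n) 0; first by rewrite s0 sqr_ge0.
  have sp : 0 < sigma n by rewrite lt_neqAle eq_sym s0 sigma0.
  have : sigma n <= C * rnorm (x n) * rnorm g.
    have <- : normc (L2dot (S (x n)) g) = sigma n.
      by rewrite Sx normc_real ger0_norm.
    by apply: le_trans (L2dot_le _ _) _; rewrite ler_wpM2r ?rnorm_ge0.
  move=> h; have : sigma n ^+ 2 <= (C * rnorm (x n) * rnorm g) ^+ 2.
    by rewrite ler_pXn2r// nnegrE// (le_trans _ h).
  by rewrite mulrAC exprMn xx -/K expr2 ler_pM2r.
have c0 : (fun i => normc (c i) ^+ 2) @ \oo --> (0 : R).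
  apply: cvg_series_cvg_0; apply: nondecreasing_is_cvgn.
    by apply/nondecreasing_seqP => n; rewrite seriesS lerDr sqr_ge0.
  by exists K => _ [n _ <-]; exact: sigmaK.
apply/cvgcP => eps eps0; have /cvgrPdist_lt/(_ (eps ^+ 2)) := c0.
rewrite exprn_gt0// => /(_ isT); apply: filterS => n.
by rewrite sub0r normrN ger0_norm ?sqr_ge0// subr0 ltr_pXn2r ?nnegrE ?normc_ge0 ?ltW.
Qed.

Fixpoint orthonormal_seq s : Prop :=
  if s is v :: s' then
    [/\ L2dot v v = 1, (forall w, w \in s' -> L2dot v w = 0) & orthonormal_seq s']
  else True.

Definition orthoproj s x := \sum_(v <- s) L2dot x v *: v.

Lemma proj_orthogonal s x w : orthonormal_seq s -> w \in s ->
  L2dot (x - orthoproj s x) w = 0.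
Proof.
elim: s => [|v s IH]//= [vv vs os]; rewrite /orthoproj big_cons -/(orthoproj s x).
rewrite inE => /orP[/eqP ->|ws].
  rewrite L2dotBl L2dotDl L2dotZl vv mulr1 opprD addNKr.
  rewrite /orthoproj L2dot_suml big_seq big1 ?oppr0// => u us.
  by rewrite L2dotZl (L2dotC u) vs// conjC0 mulr0.
by rewrite opprD addrCA L2dotDl IH// addr0 -scaleNr L2dotZl vs// mulr0.
Qed.

(** Pythagoras: the remainder is orthogonal to the projection. *)
Lemma rnorm_sub_proj s x : orthonormal_seq s -> rnorm (x - orthoproj s x) <= rnorm x.
Proof.
move=> os; set y := x - orthoproj s x.
have yp : L2dot y (orthoproj s x) = 0.
  rewrite /orthoproj L2dot_sumr big_seq big1// => v vs.
  by rewrite L2dotZr proj_orthogonal// mulr0.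
rewrite -(ler_pXn2r (n := 2)) ?nnegrE ?rnorm_ge0// -lecR -!L2dot_rnorm.
have -> : x = y + orthoproj s x by rewrite subrK.
rewrite L2dotDl !(L2dotDr _ y) (L2dotC (orthoproj s x) y) yp rmorph0 addr0 add0r.
by rewrite lerDl L2dot_rnorm ler0c sqr_ge0.
Qed.

(** If every finite orthonormal family fails, each one can be extended by a normalized witness of
    its failure; iterating from the empty family produces the sequence. *)
Lemma orthonormal_dichotomy (S : {linear L2 mu -> L2 mu}) (eps : R) :
  (exists2 s, orthonormal_seq s &
     forall x, (forall v, v \in s -> L2dot x v = 0) -> rnorm (S x) <= eps * rnorm x) \/
  (exists2 e, orthonormal e & forall n, eps < rnorm (S (e n))).
Proof.
have [?|ns] := pselect (exists2 s, orthonormal_seq s &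
     forall x, (forall v, v \in s -> L2dot x v = 0) -> rnorm (S x) <= eps * rnorm x).
  by left.
right; have /choice[nxt nxtP] s : exists x, orthonormal_seq s ->
    [/\ L2dot x x = 1, forall v, v \in s -> L2dot x v = 0 & eps < rnorm (S x)].
  have [os|] := pselect (orthonormal_seq s); last by exists 0.
  have [x [xs Sx]] : exists x, (forall v, v \in s -> L2dot x v = 0) /\
      eps * rnorm x < rnorm (S x).
    apply: contrapT => h; apply: ns; exists s => // x xs; rewrite leNgt.
    by apply/negP => Sx; apply: h; exists x.
  have x0 : rnorm x != 0.
    by apply: contraTneq Sx => x0; rewrite (rnorm0_eq0 x0) linear0 rnorm0 mulr0 ltxx.
  have rx : 0 < rnorm x by rewrite lt_neqAle eq_sym x0 rnorm_ge0.
  have r1 : rnorm ((rnorm x)^-1%:C *: x) = 1.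
    by rewrite rnormZ normc_real ger0_norm ?mulVf// invr_ge0 ltW.
  exists ((rnorm x)^-1%:C *: x) => _; split.
  - by rewrite L2dot_rnorm r1 expr1n.
  - by move=> v vs; rewrite L2dotZl xs// mulr0.
  - rewrite linearZ/= rnormZ normc_real ger0_norm ?invr_ge0 ?(ltW rx)//.
    by rewrite mulrC ltr_pdivlMr.
(* [st n] lists the first n chosen vectors, and [nxt (st n)] is the next one, orthogonal to all of
   them. *)
pose st n := iter n (fun s => nxt s :: s) [::].
have ost n : orthonormal_seq (st n).
  by elim: n => //= n IH; have [? ? _] := nxtP _ IH; split.
have mst m n : (m < n)%N -> nxt (st m) \in st n.
  elim: n => // n IH; rewrite ltnS leq_eqVlt => /orP[/eqP ->|/IH mn].
    exact: mem_head.
  by rewrite /= in_cons mn orbT.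
have o m n : (m < n)%N -> L2dot (nxt (st n)) (nxt (st m)) = 0.
  by move=> /mst; have [_ h _] := nxtP _ (ost n); exact: h.
exists (fun n => nxt (st n)) => [i j|n]; last by have [] := nxtP _ (ost n).
have [ij|ji|->] := ltngtP i j; last by have [] := nxtP _ (ost j).
  by rewrite L2dotC o// rmorph0.
exact: o.
Qed.

End orthonormal_sequences.

(** * Compact and precompact subsets of [L2] *)

Section compactness.
Context {d : measure_display} {T : measurableType d} {R : realType}.
Variable mu : {measure set T -> \bar R}.
Implicit Types (x y : L2 mu) (A K : set (L2 mu)).

Lemma nbhs_rnormP y A :
  nbhs y A <-> exists2 e : R, 0 < e & [set w | rnorm (y - w) < e] `<=` A.
Proof.
rewrite nbhs_ballP; split=> [[e /= e0 eA]|[e e0 eA]].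
  have eE : e = (complex.Re e)%:C by rewrite RRe_real// gtr0_real.
  exists (complex.Re e); first by rewrite -ltcR -eE.
  by move=> w /= yw; apply: eA; rewrite -ball_normE /= rnormC eE ltcR.
exists e%:C; first by rewrite /= ltcR.
by move=> w; rewrite -ball_normE /= rnormC ltcR => yw; exact: eA.
Qed.

Lemma nbhs_rball y (e : R) : 0 < e -> nbhs y [set w | rnorm (y - w) < e].
Proof. by move=> e0; apply/nbhs_rnormP; exists e. Qed.

(** A sequence in [A] with norms above n would cluster at some [y], although its norms eventually
    exceed |y| + 1. *)
Lemma compact_rnorm_bounded A : compact A ->
  exists M : R, forall x, A x -> rnorm x <= M.
Proof.
move=> cA; apply: contrapT => nb.
have /choice[u uP] (n : nat) : exists x, A x /\ n%:R < rnorm x.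
  apply: contrapT => h; apply: nb; exists n%:R => x Ax; rewrite leNgt.
  by apply/negP => nx; apply: h; exists x.
have uA : (u @ \oo) A by exists 0 => // n _; have [] := uP n.
have [y [_ cly]] := cA (u @ \oo) (fmap_proper_filter _ _) uA.
pose N := Num.bound (rnorm y + 1).
have yN : rnorm y + 1 < N%:R by apply: archi_boundP; rewrite addr_ge0 ?rnorm_ge0.
have uN : (u @ \oo) [set w | N%:R <= rnorm w].
  by exists N => // n /= Nn; apply: le_trans (ltW (uP n).2); rewrite ler_nat.
have [w [/= Nw yw]] := cly _ _ uN (nbhs_rball y ltr01).
have := rnormD (w - y) y; rewrite subrK rdistC; lra.
Qed.

Lemma cvg_rnormP (I : topologicalType) (F : set_system I) (FF : Filter F) (f : I -> L2 mu) y :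
  (forall e : R, 0 < e -> F [set i | rnorm (y - f i) < e]) -> f @ F --> y.
Proof.
move=> h B /nbhs_rnormP[e e0 eB].
by apply: (@filterS _ F FF _ _ _ (h e e0)) => i; exact: eB.
Qed.

(* The closure of A is shown compact with ultrafilters: the compact approximants
   force an ultrafilter to contain arbitrarily small balls, whose centers form a
   Cauchy sequence. *)
Lemma precompact_approx A :
  (forall e : R, 0 < e ->
     exists2 K : set (L2 mu), compact K &
       forall y : L2 mu, A y -> exists2 k : L2 mu, K k & rnorm (y - k) <= e) ->
  precompact A.
Proof.
move=> AK; rewrite precompactE compact_ultra => U UU Ucl.
have small (e : R) : 0 < e -> exists k, U [set w | rnorm (k - w) < e].
  move=> e0; have e4 : 0 < e / 4 by lra.
  have [K cK Kcl] := AK _ e4.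
  (* [p] picks an approximant in [K]: e/4 from [w] to a point of [A], then e/4 to [K]. Its value
     outside the closure is an irrelevant default. *)
  have /choice[p pP] (w : L2 mu) :
      exists k, closure A w -> K k /\ rnorm (w - k) < e / 2.
    have [clw|] := pselect (closure A w); last by exists 0.
    have [a [Aa /= wa]] := clw _ (nbhs_rball w e4).
    have [k Kk ak] := Kcl a Aa; exists k => _; split => //.
   by apply: le_lt_trans (rdist_triangle a _ _) _; lra.
  have pU : U (p @^-1` K) by apply: filterS Ucl => w clw; have [] := pP w clw.
  have [k [_ clk]] := cK (p @ U) (fmap_proper_filter _ _) pU.
  (* Otherwise the complement of the ball belongs to [U]; as [k] is a cluster point of [p @ U], some
     [w] of the complement has [p w] within e/2 of both [w] and [k], which is absurd. *)
  exists k; have [//|nU] := in_ultra_setVsetC [set w | rnorm (k - w) < e] UU.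
  have e2 : 0 < e / 2 by lra.
  have pU' : U (p @^-1` (p @` (closure A `&` ~` [set w | rnorm (k - w) < e]))).
    by apply: filterS (filterI Ucl nU) => w; exists w.
  have [_ [[w [clw kw] <-] /= kpw]] := clk _ _ pU' (nbhs_rball k e2).
  exfalso; apply: kw => /=; have [_] := pP w clw; rewrite rdistC => wp.
 by apply: le_lt_trans (rdist_triangle (p w) _ _) _; lra.
(* Consecutive balls meet, both being in [U]; the halved radii then keep successive centers within
   8^-k. *)
have /choice[x xP] (k : nat) : exists y, U [set w | rnorm (y - w) < 8^-1 ^+ k / 2].
  by apply: small; rewrite divr_gt0// exprn_gt0// invr_gt0.
have e8 k : 0 < (8^-1 : R) ^+ k by rewrite exprn_gt0// invr_gt0.
have [k|v vP] := @riesz_fischer _ _ _ mu x.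
  have [w [/= w1 w2]] := filter_ex (filterI (xP k) (xP k.+1)).
  apply: le_trans (rdist_triangle w _ _) _; move: w1; rewrite rdistC => w1.
  by move: w2; rewrite exprS; have := e8 k; lra.
have Uv : U --> v.
  move=> B /nbhs_rnormP[e e0 eB].
  have /cvgrPdist_lt/(_ _ e0)[k _ /(_ k (leqnn k))] :
      (fun k => 2 * 2^-1 ^+ k) @ \oo --> (0 : R).
    rewrite -[X in _ --> X](mulr0 2); apply: cvgMl_tmp; exact: cvg_half_exprn.
  rewrite sub0r normrN ger0_norm ?mulr_ge0 ?exprn_ge0// => ke.
  have k8 : (8^-1 : R) ^+ k <= 2^-1 ^+ k.
    by apply: lerXn2r; rewrite ?nnegrE ?invr_ge0//; lra.
  apply: filterS (xP k) => w /= xw; apply: eB => /=.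
  by apply: le_lt_trans (rdist_triangle (x k) _ _) _; have := vP k; lra.
exists v; split => //=; apply: closed_closure => B /Uv UB.
exact: filter_ex (filterI Ucl UB).
Qed.

(** By induction on [s]: the unit disc of coefficients lies in the compact square [-1,1]^2, and
    adding a term is a continuous image of a product of compact sets. *)
Lemma compact_combinations (s : seq (L2 mu)) (f : L2 mu -> L2 mu) :
  exists2 K, compact K & forall c : L2 mu -> R[i],
    (forall v, v \in s -> normc (c v) <= 1) -> K (\sum_(v <- s) c v *: f v).
Proof.
elim: s => [|v s [K cK KP]].
  by exists [set 0]; [exact: compact_set1 | move=> c _; rewrite big_nil].
pose F (q : (R * R) * L2 mu) := (q.1.1 +i* q.1.2) *: f v + q.2.
pose I : set R := `[-1, 1]%classic.
exists (F @` ((I `*` I) `*` K)); last first.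
  move=> c cs; rewrite big_cons.
  exists ((complex.Re (c v), complex.Im (c v)), \sum_(v <- s) c v *: f v).
    have cv := cs v (mem_head _ _); split => /=.
      split; rewrite /I /= in_itv/= -ler_norml.
        exact: le_trans (abs_Re_le _) cv.
      exact: le_trans (abs_Im_le _) cv.
    by apply: KP => w ws; apply: cs; rewrite in_cons ws orbT.
  by rewrite /F /=; case: (c v).
apply: continuous_compact; last first.
  by apply: compact_setX => //; apply: compact_setX; exact: segment_compact.
apply: continuous_subspaceT => -[[a b] y]; apply: cvg_rnormP => e e0.
pose M := rnorm (f v) + 1.
have M0 : 0 < M by rewrite ltr_pwDr// rnorm_ge0.
have eM : 0 < e / 4 / M by rewrite !divr_gt0.
have e4 : 0 < e / 4 by rewrite divr_gt0.
have n1 : \forall q \near nbhs ((a, b), y), `|a - q.1.1| < e / 4 / M.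
  have : (fun q : (R * R) * L2 mu => q.1.1) @ ((a, b), y) --> a.
    by apply: (@cvg_comp _ _ _ fst fst _ (nbhs (a, b))); exact: cvg_fst.
  by move=> /cvgrPdist_lt; apply.
have n2 : \forall q \near nbhs ((a, b), y), `|b - q.1.2| < e / 4 / M.
  have : (fun q : (R * R) * L2 mu => q.1.2) @ ((a, b), y) --> b.
    by apply: (@cvg_comp _ _ _ fst snd _ (nbhs (a, b))); [exact: cvg_fst|exact: cvg_snd].
  by move=> /cvgrPdist_lt; apply.
have n3 : \forall q \near nbhs ((a, b), y), rnorm (y - q.2) < e / 4.
  have : (fun q : (R * R) * L2 mu => q.2) @ ((a, b), y) --> y by exact: cvg_snd.
  by move=> h; exact: (h _ (nbhs_rball y e4)).
apply: filterS3 n1 n2 n3 => -[[a' b'] y'] /= aa bb yy.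
rewrite /F /= opprD addrACA -scalerBl; apply: le_lt_trans (rnormD _ _) _.
rewrite rnormZ.
have cab : normc ((a +i* b) - (a' +i* b')) <= `|a - a'| + `|b - b'|.
  rewrite -(ler_pXn2r (n := 2)) ?nnegrE ?normc_ge0 ?addr_ge0//.
  rewrite sqr_Re_normc /= -[X in X + _ <= _]real_normK ?num_real//.
  rewrite -[X in _ + X <= _]real_normK ?num_real//.
  have := normr_ge0 (a - a'); have := normr_ge0 (b - b'); nra.
have : normc ((a +i* b) - (a' +i* b')) * rnorm (f v) <= (e / 2 / M) * M.
  apply: ler_pM; rewrite ?normc_ge0 ?rnorm_ge0//; last by rewrite lerDl.
  apply: le_trans cab _; lra.
rewrite divfK ?gt_eqF//; lra.
Qed.

End compactness.

(** * Compact operators, weak convergence and quadratic forms *)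

Section operators_on_L2.
Context {d : measure_display} {T : measurableType d} {R : realType}.
Variable mu : {measure set T -> \bar R}.
Variable S : {linear L2 mu -> L2 mu}.

Definition weakly_null (k : nat -> L2 mu) :=
  forall g, (fun n => L2dot (k n) g) @ \oo --> (0 : R[i]).

(** The bound [M] is an element of [R[i]], but [M] times the norm of [u] is nonnegative, hence equal
    to its own modulus. *)
Lemma bounded_rbounded : bounded_operator S -> exists C, rbounded S C.
Proof.
move=> [M SM]; exists (normc M) => u; rewrite -lecR rmorphM/= -!rnormC -normcC.
have h := SM u; have h0 : 0 <= M * `|u| by apply: le_trans h.
by apply: le_trans h _; rewrite -[leLHS]ger0_norm// normrM normr_id.
Qed.

Lemma rbounded_bounded C : rbounded S C -> bounded_operator S.
Proof. by move=> SC; exists C%:C => u; rewrite !rnormC -rmorphM/= lecR. Qed.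

Lemma compact_rbounded : compact_operator S -> exists C, rbounded S C.
Proof.
rewrite /compact_operator precompactE => /compact_rnorm_bounded[M MP].
exists M => u; have [u0|u0] := eqVneq (rnorm u) 0.
  by rewrite (rnorm0_eq0 u0) linear0 rnorm0 mulr0.
have ru : 0 < rnorm u by rewrite lt_neqAle eq_sym u0 rnorm_ge0.
pose v := (rnorm u)^-1%:C *: u.
have Zr x : rnorm ((rnorm u)^-1%:C *: x) = (rnorm u)^-1 * rnorm x.
  by rewrite rnormZ normc_real ger0_norm// invr_ge0 ltW.
have : rnorm (S v) <= M.
  by apply/MP/subset_closure; exists v => //=; rewrite rnormC Zr mulVf.
by rewrite linearZ Zr mulrC ler_pdivrMr.
Qed.

Lemma compact_finite_rank_approx (eps : R) : compact_operator S -> 0 < eps ->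
  exists2 s : seq (L2 mu), orthonormal_seq s &
    forall x, (forall v, v \in s -> L2dot x v = 0) -> rnorm (S x) <= eps * rnorm x.
Proof.
move=> cS eps0; have [C SC] := compact_rbounded cS.
have [//|[e oe Se]] := orthonormal_dichotomy S eps; exfalso.
move: cS; rewrite /compact_operator precompactE => cS.
have Se1 n : closure (S @` [set u | `|u| <= 1]) (S (e n)).
  apply: subset_closure; exists (e n) => //=.
  by rewrite L2normE oe eqxx sqrtC1.
have SeF : ((fun n => S (e n)) @ \oo) (closure (S @` [set u | `|u| <= 1])).
  by exists 0 => // n _; exact: Se1.
have [y [_ cly]] := cS _ (fmap_proper_filter _ _) SeF.
pose r := rnorm y + 1.
have r0 : 0 < r by rewrite ltr_pwDr// rnorm_ge0.
(* Closeness eps/4 forces |y| > 3/4 eps, while the second bound and weak nullity force |y|^2 < eps^2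
   / 2, below 9/16 eps^2. *)
pose del := Num.min (eps / 4) (eps ^+ 2 / 4 / r).
have del0 : 0 < del by rewrite lt_min !divr_gt0 ?exprn_gt0.
have SeA : ((fun n => S (e n)) @ \oo)
    [set w | normc (L2dot w y) < eps ^+ 2 / 4 /\ eps < rnorm w].
  have /cvgcP/(_ (eps ^+ 2 / 4)) := orthonormal_weak0 y SC oe.
  rewrite divr_gt0 ?exprn_gt0// => /(_ isT); apply: filterS => n.
  by rewrite subr0.
have [w [/= [wy w1] yw]] := cly _ _ SeA (nbhs_rball y del0).
have [yw1 yw2] : rnorm (y - w) < eps / 4 /\ rnorm (y - w) * r < eps ^+ 2 / 4.
  by move: yw; rewrite lt_min => /andP[? ?]; rewrite -ltr_pdivlMr.
have yy : rnorm y ^+ 2 <= rnorm (y - w) * rnorm y + normc (L2dot w y).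
  have <- : normc (L2dot y y) = rnorm y ^+ 2.
    by rewrite L2dot_rnorm normc_real ger0_norm ?sqr_ge0.
  rewrite -{1}[y](subrK w) L2dotDl; apply: le_trans (normcD _ _) _.
  by rewrite lerD2r L2dot_le.
have yr : rnorm (y - w) * rnorm y <= rnorm (y - w) * r.
  by rewrite ler_wpM2l ?rnorm_ge0// lerDl.
have := rnormD (w - y) y; rewrite subrK rdistC => wle.
have := rnorm_ge0 y; nra.
Qed.

Lemma linear_orthoproj (s : seq (L2 mu)) (x : L2 mu) :
  S (orthoproj s x) = \sum_(v <- s) L2dot x v *: S v.
Proof. by rewrite /orthoproj linear_sum; apply: eq_bigr => v _; rewrite linearZ. Qed.

(** Split [k n] along a finite orthonormal family: the projected part has finitely many
    coefficients, all tending to 0, and [S] is uniformly small on the bounded remainder. *)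
Lemma compact_weakly_null k : compact_operator S -> weakly_null k ->
  (fun n => rnorm (S (k n))) @ \oo --> (0 : R).
Proof.
move=> cS k0.
have [M kM] : exists M : R, forall n, rnorm (k n) <= M.
  by apply: uniform_boundedness => g; apply: cvgc_bounded (k0 g).
have M0 : 0 <= M by apply: le_trans (kM 0); exact: rnorm_ge0.
apply/cvgrPdist_lt => e e0.
have e1 : 0 < e / 2 / (M + 1) by rewrite !divr_gt0// ltr_wpDl.
have [s os sP] := compact_finite_rank_approx cS e1.
have s0 : (fun n => \sum_(v <- s) normc (L2dot (k n) v) * rnorm (S v)) @ \oo --> (0 : R).
  elim: (s) => [|v s' IH].
    rewrite (_ : (fun n => _) = cst 0); first exact: cvg_cst.
    by apply/funext => n; rewrite big_nil.
  rewrite (_ : (fun n => _) = (fun n => normc (L2dot (k n) v) * rnorm (S v)) \+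
      (fun n => \sum_(v <- s') normc (L2dot (k n) v) * rnorm (S v))); last first.
    by apply/funext => n; rewrite big_cons.
  rewrite -[X in _ --> X]addr0; apply: cvgD => //.
  rewrite -[X in _ --> X](mul0r (rnorm (S v))); apply: cvgMr_tmp.
  have /cvgcP h := k0 v; apply/cvgrPdist_lt => eps /h; apply: filterS => n.
  by rewrite subr0 sub0r normrN ger0_norm ?normc_ge0.
have e2 : 0 < e / 2 by rewrite divr_gt0.
move/cvgrPdist_lt/(_ _ e2) : s0; apply: filterS => n; rewrite !sub0r !normrN.
rewrite [X in _ -> X < _]ger0_norm ?rnorm_ge0// => /(le_lt_trans (ler_norm _)) h.
have -> : S (k n) = S (orthoproj s (k n)) + S (k n - orthoproj s (k n)).
  by rewrite -linearD addrC subrK.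
apply: le_lt_trans (rnormD _ _) _; rewrite (splitr e); apply: ltr_leD.
  rewrite linear_orthoproj; apply: le_lt_trans (rnorm_sum _ _) _; apply: le_lt_trans h.
  by under eq_bigr do rewrite rnormZ.
have := sP (k n - orthoproj s (k n)) (fun v vs => proj_orthogonal _ os vs).
move=> /le_trans; apply.
apply: (@le_trans _ _ (e / 2 / (M + 1) * (M + 1))).
  rewrite ler_wpM2l ?(ltW e1)//; apply: le_trans (rnorm_sub_proj _ os) _.
  by apply: le_trans (kM n) _; rewrite lerDl.
by rewrite divfK// gt_eqF// ltr_wpDl.
Qed.

(** With k = h_n - h, the difference of the forms is <S k, h_n> + <S h, k>: the first term is small
    in norm since h_n is bounded, the second by weak convergence. *)
Lemma compact_form_cvg (h_ : nat -> L2 mu) h : compact_operator S ->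
  (forall g, (fun n => L2dot (h_ n) g) @ \oo --> L2dot h g) ->
  (fun n => L2dot (S (h_ n)) (h_ n)) @ \oo --> L2dot (S h) h.
Proof.
move=> cS hh; pose k n := h_ n - h.
have k0 : weakly_null k by move=> g; apply/L2dot_cvg_sub; exact: hh.
have Sk := compact_weakly_null cS k0.
have [M hM] : exists M : R, forall n, rnorm (h_ n) <= M.
  by apply: uniform_boundedness => g; apply: cvgc_bounded (hh g).
have split_form n : L2dot (S (h_ n)) (h_ n) - L2dot (S h) h =
    L2dot (S (k n)) (h_ n) + L2dot (S h) (k n).
  by rewrite linearB L2dotBl L2dotBr addrA subrK.
apply/cvgcP => e e0.
have M0 : 0 < M + 1 by rewrite ltr_wpDl// (le_trans _ (hM 0))// rnorm_ge0.
have e2 : 0 < e / 2 by rewrite divr_gt0.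
have e3 : 0 < e / 2 / (M + 1) by rewrite divr_gt0.
have /cvgrPdist_lt/(_ _ e3) := Sk; have /cvgcP/(_ _ e2) := k0 (S h).
apply: filterS2 => n; rewrite subr0 sub0r normrN ger0_norm ?rnorm_ge0// => kS Sn.
rewrite split_form; apply: le_lt_trans (normcD _ _) _; rewrite (splitr e).
apply: ler_ltD; last by rewrite L2dotC normc_conj.
apply: le_trans (L2dot_le _ _) _.
apply: (@le_trans _ _ (e / 2 / (M + 1) * (M + 1))).
  by apply: ler_pM; rewrite ?rnorm_ge0 ?(ltW Sn)// (le_trans (hM n))// lerDl.
by rewrite divfK// gt_eqF.
Qed.

(** On the unit ball, [S] is within eps of [S] composed with [orthoproj s], whose values are
    combinations of the [S v] with coefficients of modulus at most 1. *)
Lemma finite_rank_approx_compact :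
  (forall eps : R, 0 < eps -> exists2 s : seq (L2 mu), orthonormal_seq s &
    forall x, (forall v, v \in s -> L2dot x v = 0) -> rnorm (S x) <= eps * rnorm x) ->
  compact_operator S.
Proof.
move=> SP; apply: precompact_approx => e e0.
have [s os sP] := SP _ e0; have [K cK KP] := compact_combinations s S.
exists K => // _ [x /= x1 <-].
have {}x1 : rnorm x <= 1 by rewrite -lecR -rnormC.
exists (\sum_(v <- s) L2dot x v *: S v).
  apply: KP => v vs; apply: le_trans (L2dot_le _ _) _.
  suff -> : rnorm v = 1 by rewrite mulr1.
  have vv : L2dot v v = 1.
    elim: (s) os vs => //= w s' IH [ww _ os']; rewrite inE => /orP[/eqP -> //|].
    exact: IH.
  by apply: complexI; rewrite -rnormC L2normE vv sqrtC1.
rewrite -linear_orthoproj -linearB; apply: le_trans (sP _ _) _.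
  by move=> v; exact: proj_orthogonal.
rewrite -[leRHS]mulr1 ler_wpM2l ?(ltW e0)//.
exact: le_trans (rnorm_sub_proj _ os) x1.
Qed.

Lemma polarization x y : 4 * L2dot (S x) y =
  L2dot (S (x + y)) (x + y) - L2dot (S (x - y)) (x - y) +
  'i * L2dot (S (x + 'i *: y)) (x + 'i *: y) -
  'i * L2dot (S (x - 'i *: y)) (x - 'i *: y).
Proof.
rewrite !(linearD, linearN, linearZ)/= !(L2dotDl, L2dotDr, L2dotNl, L2dotNr, L2dotZl, L2dotZr).
have ci : conjC ('i : R[i]) = - 'i by apply/eqP; rewrite eq_complex/= oppr0 !eqxx.
have ii : 'i * 'i = -1 :> R[i] by rewrite -expr2 sqr_i.
rewrite ci.
move: (L2dot (S x) x) (L2dot (S x) y) (L2dot (S y) x) (L2dot (S y) y) => P X Y W.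
(* Isolating the multiple of i^2 + 1 leaves an identity valid with i as an indeterminate. *)
transitivity (4 * X + ('i * 'i + 1) * (2 * Y - 2 * X)); first by rewrite ii addNr mul0r addr0.
ring.
Qed.

Lemma form_cvg_compact : bounded_operator S ->
  (forall k, weakly_null k -> (fun n => L2dot (S (k n)) (k n)) @ \oo --> (0 : R[i])) ->
  compact_operator S.
Proof.
move=> /bounded_rbounded[C SC] Sk; apply: finite_rank_approx_compact => eps eps0.
have [//|[e oe Se]] := orthonormal_dichotomy S eps; exfalso.
have w0 : weakly_null (fun n => S (e n)).
  by move=> g; exact: orthonormal_weak0 SC oe.
have e0 : weakly_null e.
  have id1 : rbounded (idfun : {linear L2 mu -> L2 mu}) 1 by move=> u; rewrite mul1r.
  by move=> g; exact: orthonormal_weak0 id1 oe.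
have c0 (c : R[i]) : normc c = 1 -> weakly_null (fun n => e n + c *: S (e n)).
  move=> c1 g; apply/cvgcP => del del0.
  have d2 : 0 < del / 2 by rewrite divr_gt0.
  have /cvgcP/(_ _ d2) := e0 g; have /cvgcP/(_ _ d2) := w0 g.
  apply: filterS2 => n; rewrite !subr0 L2dotDl L2dotZl => n1 n2.
  apply: le_lt_trans (normcD _ _) _.
  by rewrite Normc.normcM c1 mul1r (splitr del) ltrD.
have i1 : normc ('i : R[i]) = 1.
  by rewrite /Normc.normc expr0n add0r expr1n sqrtr1.
have N1 : normc (- 1 : R[i]) = 1 by rewrite (normcN (1 : Rcomplex R)) Normc.normc1.
have Ni1 : normc (- 'i : R[i]) = 1 by rewrite (normcN ('i : Rcomplex R)) i1.
have eps2 : 0 < eps ^+ 2 by rewrite exprn_gt0.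
have q c c1 := (cvgcP _ _).1 (Sk _ (c0 c c1)) _ eps2.
(* A single index makes all four forms smaller than eps^2, so polarization gives 4 |S e_n|^2 < 4
   eps^2, against the choice of [e]. *)
have [n [[[n1 n2] n3] n4]] :=
  filter_ex (filterI (filterI (filterI (q 1 (Normc.normc1 R)) (q _ N1)) (q _ i1)) (q _ Ni1)).
move: n1 n2 n3 n4; rewrite /= !subr0 scale1r !scaleNr scale1r.
set q1 := L2dot _ _; set q2 := L2dot _ _; set q3 := L2dot _ _; set q4 := L2dot _ _.
move=> n1 n2 n3 n4.
have := polarization (e n) (S (e n)); rewrite -/q1 -/q2 -/q3 -/q4 L2dot_rnorm => pol.
have : normc (4 * (rnorm (S (e n)) ^+ 2)%:C) < 4 * eps ^+ 2.
  rewrite pol.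
  apply: le_lt_trans (normcD _ _) _; rewrite (normcN (_ : Rcomplex R)).
  have := normcD (q1 - q2) ('i * q3); have := normcD q1 (- q2).
  rewrite (normcN (_ : Rcomplex R)) !Normc.normcM i1 !mul1r; lra.
rewrite Normc.normcM normc_real ger0_norm ?sqr_ge0// normc_nat ltr_pM2l//.
by rewrite ltNge lerXn2r ?nnegrE ?(ltW eps0) ?rnorm_ge0// ltW.
Qed.

End operators_on_L2.

(** * Time-frequency shifts and the two inclusions *)

Section time_frequency_shifts.
Variables (R : realType) (n : nat).
Local Notation mu := (lebesgue_rV R n).

Lemma tf_shift0 : tf_shift (0, 0) = id :> (L2 mu -> L2 mu).
Proof.
apply/funext => u; rewrite -[u]reprK tf_shiftE; apply/eq_L2P/aeW => y /=.
rewrite /tf_fun /tf_phase subr0 big1 ?mulr0 => [|i _]; last by rewrite mxE mul0r.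
by rewrite /expi cos0 sin0 -[X in X * _]/(1 : R[i]) mul1r.
Qed.

Lemma alpha0 (S : L2 mu -> L2 mu) : alpha (0, 0) S = S.
Proof. by rewrite /alpha tf_shift0 (@adjointE _ _ _ _ id id). Qed.

(** [adjoint] is a choice with a default value; the explicit formula for shifts guarantees the
    defining identity. *)
Lemma adjoint_tf_shiftP z (u v : L2 mu) :
  L2dot (tf_shift z u) v = L2dot u (adjoint (tf_shift z) v).
Proof. by case: z => x xi; rewrite adjoint_tf_shift L2dot_tf_shift. Qed.

End time_frequency_shifts.

Theorem proposition5p5 (R : realType) (d : nat) :
  B_pt R d = compact_operators R d.
Proof.
apply/seteqP; split => S /=.
  move=> [bS QS]; apply: form_cvg_compact => // k k0.
  (* At the origin of phase space [Q] is the plain quadratic form of [S], and the weak limit is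
     0. *)
  have := QS k 0 _ (0, 0); rewrite /Q alpha0 linear0 L2dot0l; apply.
  by move=> g; rewrite L2dot0l; exact: k0.
move=> cS; split; first by have [C /rbounded_bounded] := compact_rbounded cS.
move=> f_ f ff z.
set A := adjoint (tf_shift z).
have QE u : Q S u z = L2dot (S (A u)) (A u) by rewrite /Q adjoint_tf_shiftP.
(* Moving [A] to the other side shows that it preserves weak convergence. *)
have AE u g : L2dot (A u) g = L2dot u (tf_shift z g).
  by rewrite L2dotC -adjoint_tf_shiftP -L2dotC.
have Aff g : (fun n => L2dot (A (f_ n)) g) @ \oo --> L2dot (A f) g.
  rewrite AE (_ : (fun n => _) = fun n => L2dot (f_ n) (tf_shift z g)).
    exact: ff.
  by apply/funext => n; exact: AE.
rewrite QE (_ : (fun n => _) = fun n => L2dot (S (A (f_ n))) (A (f_ n))).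
  exact: (@compact_form_cvg _ _ _ _ S (fun n => A (f_ n)) (A f) cS Aff).
by apply/funext => n; exact: QE.
Qed.
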